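(* For every pair of positive integers $(n,d)$ there exists a positive integer $N(n,d)$ such that the following three statements are equivalent: (a) $CDC(n,0,d)$; (b) $CDC(n,p,d)$ holds for every prime $p>N(n,d)$; (c) $NDC(n,p,d)$ holds for every prime $p>N(n,d)$.
   Context: For a field $K$, $A_n(K)$ is the associative $K$-algebra generated by $Y_1,\ldots,Y_{2n}$ with relations $[Y_i,Y_{j+n}]=\delta_{ij}$, $[Y_i,Y_j]=[Y_{i+n},Y_{j+n}]=0$ ($1\le i,j\le n$); it has $K$-basis the ordered monomials $Y_1^{a_1}\cdots Y_{2n}^{a_{2n}}$, the degree of an element is the maximal total degree of its monomials, and the degree of a $K$-algebra endomorphism $\phi$ is $\max_i\deg\phi(Y_i)$. If $K$ has prime characteristic $p$, the center of $A_n(K)$ is $K[Y_1^p,\ldots,Y_{2n}^p]$, identified with $K[X_1,\ldots,X_{2n}]$ via $X_i=Y_i^p$; every endomorphism $\phi$ maps it into itself, giving a $K$-algebra endomorphism $\phi_0$ of $K[X_1,\ldots,X_{2n}]$. For $p$ prime and $K$ of characteristic $p$, $CDC(n,p,d,K)$ is the statement: ''an endomorphism $\phi$ of $A_n(K)$ of degree at most $d$ is an automorphism if and only if $K(X_1,\ldots,X_{2n})$ is a finite extension of $K(\phi_0(X_1),\ldots,\phi_0(X_{2n}))$ of degree not divisible by $p$ and, in case $p\le n$, $\det\left(\frac{\partial\phi_0(X_i)}{\partial X_j}\right)$ is a nonzero element of $K$''. For $K$ of characteristic $0$ (where the center is $K$ and these conditions are vacuous), $CDC(n,0,d,K)$ is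 the statement ''every endomorphism of $A_n(K)$ of degree at most $d$ is an automorphism''. For any characteristic $p$, $NDC(n,p,d,K)$ is: ''every endomorphism of $A_n(K)$ of degree at most $d$ is an automorphism''. $CDC(n,p,d)$ (resp. $NDC(n,p,d)$) means $CDC(n,p,d,K)$ (resp. $NDC(n,p,d,K)$) holds for all fields $K$ of characteristic $p$. *)

(* Defs.v *)
From HB Require Import structures.
From mathcomp Require Import all_boot all_order all_algebra.
From mathcomp Require Import fraction mpoly.
Set Implicit Arguments.
Unset Strict Implicit.
Unset Printing Implicit Defensive.
Import GRing.Theory.
Local Open Scope ring_scope.

(* The Weyl algebra A_n(K), generators Y_1..Y_2n (here indexed by 'I_(n+n), *)
(* 0-based), relations [Y_i, Y_(j+n)] = delta_ij, [Y_i,Y_j] = 0,             *)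
(* [Y_(i+n),Y_(j+n)] = 0.                                                    *)
(* Model: the underlying K-vector space is {mpoly K[n+n]}, the monomial      *)
(* 'X_[m] standing for the ordered basis monomial Y_1^m_1 ... Y_2n^m_2n.     *)
(* Only the K-vector-space structure of {mpoly K[n+n]} is used; the Weyl     *)
(* product is [weylmul] below (NOT the commutative product of mpoly).        *)
Section Weyl.
Variables (n : nat) (K : fieldType).

Definition weyl := {mpoly K[n + n]}.

Definition wmon (m : 'X_{1..n + n}) : weyl := 'X_[m].

Definition bumpm (m : 'X_{1..n + n}) (j : 'I_(n + n)) : 'X_{1..n + n} :=
  [multinom (m k + (k == j))%N | k < n + n].
Definition dropm (m : 'X_{1..n + n}) (j : 'I_(n + n)) : 'X_{1..n + n} :=
  [multinom (m k - (k == j))%N | k < n + n].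

(* Left multiplication by the generator Y_j on a basis monomial.
   For j = i < n :      Y_i * Y^m = Y^(m + e_i)   (Y_i comes first in the order)
   For j = n + i :      Y_(i+n) Y_i^a = Y_i^a Y_(i+n) - a Y_i^(a-1),
                        so Y_(i+n) * Y^m = Y^(m + e_(i+n)) - m_i Y^(m - e_i). *)
Definition lmulY_mon (j : 'I_(n + n)) (m : 'X_{1..n + n}) : weyl :=
  match split j with
  | inl i => wmon (bumpm m j)
  | inr i => wmon (bumpm m j) - (m (lshift n i))%:R *: wmon (dropm m (lshift n i))
  end.

Definition lmulY (j : 'I_(n + n)) (q : weyl) : weyl :=
  \sum_(m <- msupp q) q@_m *: lmulY_mon j m.

Definition weylmul (p q : weyl) : weyl :=
  \sum_(m <- msupp p) p@_m *:
     foldr (fun j r => iter (m j) (lmulY j) r) q (ord_enum (n + n)).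

Definition weylone : weyl := wmon 0%MM.

Definition Ygen (j : 'I_(n + n)) : weyl := wmon (bumpm 0%MM j).

Definition wexp (a : weyl) (k : nat) : weyl := iter k (weylmul a) weylone.

Definition is_weyl_endo (phi : weyl -> weyl) : Prop :=
  [/\ forall a b, phi (a + b) = phi a + phi b,
      forall (c : K) a, phi (c *: a) = c *: phi a,
      forall a b, phi (weylmul a b) = weylmul (phi a) (phi b)
    & phi weylone = weylone].

Definition is_weyl_auto (phi : weyl -> weyl) : Prop :=
  is_weyl_endo phi /\ bijective phi.

(* degree of an element = maximal total degree of its monomials;
   msize q = that degree + 1 (and 0 for q = 0).
   deg phi <= d  iff  deg phi(Y_j) <= d for all j. *)
Definition weyl_endo_deg_le (phi : weyl -> weyl) (d : nat) : Prop :=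
  forall j, (msize (phi (Ygen j)) <= d.+1)%N.

(* K[X_1..X_2n] and the identification with K[Y_1^p,...,Y_2n^p]
   via X_i = Y_i^p : X^m |-> Y_1^(p m_1) ... Y_2n^(p m_2n). *)
Definition polyX := {mpoly K[n + n]}.

Definition center_iota (p : nat) (f : polyX) : weyl :=
  \sum_(m <- msupp f) f@_m *: wmon [multinom (p * m k)%N | k < n + n].

Definition gen_subfield (f : 'I_(n + n) -> polyX) : {fraction polyX} -> Prop :=
  fun u => exists g h : polyX,
      (h \mPo [tuple f i | i < n + n]) != 0 /\
      u = (tofrac (g \mPo [tuple f i | i < n + n])) / (tofrac (h \mPo [tuple f i | i < n + n])).

Definition ext_degree (L : {fraction polyX} -> Prop) (r : nat) : Prop :=
  exists b : 'I_r -> {fraction polyX},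
    (forall u, exists c : 'I_r -> {fraction polyX},
        (forall k, L (c k)) /\ u = \sum_k c k * b k) /\
    (forall c : 'I_r -> {fraction polyX},
        (forall k, L (c k)) -> \sum_k c k * b k = 0 -> forall k, c k = 0).

Definition jacobian (f : 'I_(n + n) -> polyX) : polyX :=
  \det (\matrix_(i < n + n, j < n + n) mderiv j (f i)).

(* CDC(n,p,d,K) for K of characteristic p; phi0 i = phi_0(X_i) is
   characterised by iota(phi_0(X_i)) = phi(Y_i^p). *)
Definition CDC_p_K (p d : nat) : Prop :=
  forall phi : weyl -> weyl, is_weyl_endo phi -> weyl_endo_deg_le phi d ->
  forall phi0 : 'I_(n + n) -> polyX,
    (forall i, center_iota p (phi0 i) = phi (wexp (Ygen i) p)) ->
    (is_weyl_auto phi <->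
       ((exists r, ~~ (p %| r)%N /\ ext_degree (gen_subfield phi0) r) /\
        ((p <= n)%N -> exists c : K, c != 0 /\ jacobian phi0 = c%:MP))).

Definition NDC_K (d : nat) : Prop :=
  forall phi : weyl -> weyl, is_weyl_endo phi -> weyl_endo_deg_le phi d ->
    is_weyl_auto phi.

End Weyl.

Definition CDC0 (n d : nat) : Prop :=
  forall K : fieldType, [pchar K] =i pred0 -> NDC_K n K d.

Definition CDC (n p d : nat) : Prop :=
  forall K : fieldType, p \in [pchar K] -> CDC_p_K n K p d.

Definition NDC (n p d : nat) : Prop :=
  forall K : fieldType, p \in [pchar K] -> NDC_K n K d.

(* Main.v *)
(* If CDC(n,0,d) holds, the bound N exists by compactness: an ultraproduct, over primes
   tending to infinity, of endomorphisms of degree at most d that are not automorphisms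
   is an endomorphism of degree at most d in characteristic 0, hence has an inverse, and
   this inverse descends to some factor. For p > n, NDC implies CDC, because an
   automorphism preserves the centre and therefore induces an automorphism of it.

   If CDC(n,0,d) fails, any N will do, because a counterexample phi in characteristic 0
   specialises to counterexamples modulo almost every p. Let r = (d+1)^(2n). Counting
   monomials shows that r+1 elements of small degree are right linearly dependent over
   the image of an endomorphism of degree at most d. Applied to the powers of a
   generator, this bounds by r the degree of the inverse of an automorphism, so that
   failure of surjectivity is witnessed by a linear form, which can be reduced modulo p.
   Applied to monomials of degree less than p, it shows that the Weyl algebra has rank at
   most r over the image of the reduction of phi (the dimension can increase only in the
   first r degrees); hence K(X) has degree at most r over K(phi_0(X)), and this degree is
   prime to p once p > r+1. That phi maps the centre to the centre follows from the
   independence over the centre of the p^(2n) monomials in the images of the generators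
   with exponents less than p. *)
Require Import Defs.
From HB Require Import structures.
From mathcomp Require Import all_boot all_order all_algebra.
From mathcomp Require Import generic_quotient ring_quotient fraction.
From mathcomp Require Import ssrcomplements mpoly zify.
From mathcomp Require Import boolp.
From mathcomp Require classical_sets.
Set Implicit Arguments.
Unset Strict Implicit.
Unset Printing Implicit Defensive.
Import GRing.Theory.
Local Open Scope ring_scope.

(** * The Weyl algebra *)

(** In characteristic [p] the endomorphism is not known in advance to be injective, and no skew
    field of fractions is built. Independence over its image therefore tests coefficients after
    applying the morphism; a nonzero element is sure to have a nonzero image only in degree less
    than [p], which is why the rank argument has to stabilise within the first r degrees; and
    denominators are taken in the image of the centre, where they commute with everything.

    The value of r: an element of degree [M] times the image of an element of degree [M] has degree
    at most [(d+1)M], and passing from [M] to [(d+1)M] multiplies the number of monomials in [2n]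
    variables by at most [(d+1)^(2n)]. The bound does not depend on the field, so the linear form
    can be fixed in characteristic 0 before [p] is chosen.

    The algebra is built over commutative rings: the ultraproduct works over a product of fields,
    the reduction over an iterated polynomial ring over the integers with a morphism to [K], under
    which zero is again tested. *)

Section Operators.
Variables (n : nat) (R : comNzRingType).
Local Notation V := {mpoly R[n + n]}.
Implicit Types (i j : 'I_(n + n)) (m : 'X_{1..n + n}) (a b c q : V).

(* Left multiplication by [Y_j]; [wR] is the right multiplication. *)
Definition wL j q : V :=
  match split j with
  | inl _ => 'X_j * q
  | inr i => 'X_j * q - mderiv (lshift n i) q
  end.

Definition wR j q : V :=
  match split j with
  | inl i => 'X_j * q - mderiv (rshift n i) q
  | inr _ => 'X_j * q
  end.

Lemma wL_is_linear j : linear (wL j).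
Proof.
move=> c p q; rewrite /wL; case: split => i.
  by rewrite mulrDr -scalerAr.
by rewrite mulrDr linearP -scalerAr scalerBr opprD addrACA.
Qed.
HB.instance Definition _ j := GRing.isLinear.Build R V V _ (wL j) (wL_is_linear j).

Lemma wR_is_linear j : linear (wR j).
Proof.
move=> c p q; rewrite /wR; case: split => i.
  by rewrite mulrDr linearP -scalerAr scalerBr opprD addrACA.
by rewrite mulrDr -scalerAr.
Qed.
HB.instance Definition _ j := GRing.isLinear.Build R V V _ (wR j) (wR_is_linear j).

Lemma mderivXU i j : mderiv i ('X_j : V) = (i == j)%:R.
Proof.
rewrite mderivX mnm1E eq_sym; case: eqP => [->|_]; last by rewrite scale0r.
by rewrite scale1r -{1}[U_(j)%MM]add0m addmK mpolyX0.
Qed.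

(** When both operators differentiate, the Leibniz rule produces the same multiple of [q] on either
    side; in the other cases the derivation does not see the other variable. *)
Lemma wLR_comm i j q : wL i (wR j q) = wR j (wL i q).
Proof.
rewrite /wL /wR; case: (splitP i) => i' Ei; case: (splitP j) => j' Ej.
- rewrite mulrBr mderivM mderivXU -val_eqE /= Ei gtn_eqF; last by rewrite ltn_addr.
  by rewrite mul0r add0r mulrCA.
- by rewrite mulrCA.
- rewrite !mulrBr !mderivB !mderivM !mderivXU -!val_eqE /= Ei Ej eqn_add2l.
  rewrite (eq_sym (j' : nat)) (mderiv_comm (rshift n j')).
  rewrite [in RHS]mulrCA !opprB !opprD.

  rewrite -!addrA; congr (_ + _); rewrite addrCA [RHS]addrCA; congr (_ + _).
  by rewrite addrCA [RHS]addrCA; congr (_ + _); apply: addrC.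
- rewrite mulrBr mderivM mderivXU -val_eqE /= Ej ltn_eqF; last by rewrite ltn_addr.
  by rewrite mul0r add0r mulrCA.
Qed.

Definition wLm m q : V := foldr (fun j r => iter (m j) (wL j) r) q (ord_enum (n + n)).
(** Right multiplication by an ordered product applies its first factor first, hence the reversed
    enumeration. *)
Definition wRm m q : V :=
  foldr (fun j r => iter (m j) (wR j) r) q (rev (ord_enum (n + n))).

Lemma iter_comm (T : Type) (f g : T -> T) k x :
  (forall y, f (g y) = g (f y)) -> f (iter k g x) = iter k g (f x).
Proof. by move=> fg; elim: k => //= k <-. Qed.

Lemma foldr_iter_comm (T I : Type) (f : T -> T) (g : I -> T -> T) (e : I -> nat) (s : seq I) x :
  (forall (k : I) y, f (g k y) = g k (f y)) ->
  f (foldr (fun t r => iter (e t) (g t) r) x s) =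
  foldr (fun t r => iter (e t) (g t) r) (f x) s.
Proof. by move=> fg; elim: s => //= t s IH; rewrite iter_comm ?IH. Qed.

Lemma wLm_is_linear m : linear (wLm m).
Proof.
move=> c p q; rewrite /wLm; elim: (ord_enum _) => //= j s ->.
by elim: (m j) => //= k ->; rewrite linearP.
Qed.
HB.instance Definition _ m := GRing.isLinear.Build R V V _ (wLm m) (wLm_is_linear m).

Lemma wRm_is_linear m : linear (wRm m).
Proof.
move=> c p q; rewrite /wRm; elim: (rev _) => //= j s ->.
by elim: (m j) => //= k ->; rewrite linearP.
Qed.
HB.instance Definition _ m := GRing.isLinear.Build R V V _ (wRm m) (wRm_is_linear m).

Lemma wLRm_comm m m' q : wLm m (wRm m' q) = wRm m' (wLm m q).
Proof.
apply: foldr_iter_comm => j y; symmetry.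
by apply: foldr_iter_comm => i z; rewrite wLR_comm.
Qed.

Lemma ord_enum_split :
  ord_enum (n + n) = map (lshift n) (ord_enum n) ++ map (@rshift n n) (ord_enum n).
Proof.
apply: (inj_map val_inj); rewrite val_ord_enum map_cat -!map_comp iotaD add0n.
rewrite -[in iota 0 n](val_ord_enum n) -[n in iota n]addn0 iotaDl -(val_ord_enum n).
by rewrite -map_comp.
Qed.

(** On such [q] the correction terms of [wL] (or of [wR], for the other half of the variables)
    vanish, and the operators act as commutative multiplication by a variable. *)
Definition dvanish (K : 'I_n -> 'I_(n + n)) q :=
  forall k : 'I_n, mderiv (K k) q = 0.

Lemma dvanish_mulX (K : 'I_n -> 'I_(n + n)) j k q :
  (forall t : 'I_n, K t != j) ->
  dvanish K q -> dvanish K ('X_[U_(j) *+ k] * q).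
Proof.
move=> Kj qK i; rewrite mderivM qK mulr0 addr0 mderivX mulmnE mnm1E eq_sym.
by rewrite (negPf (Kj i)) mul0n scale0r mul0r.
Qed.

Lemma foldr_mulX (g : 'I_(n + n) -> V -> V) (K : 'I_n -> 'I_(n + n)) (e : 'I_(n + n) -> nat) s q :
  (forall j, j \in s -> forall t : 'I_n, K t != j) ->
  (forall j q, dvanish K q -> g j q = 'X_j * q) -> dvanish K q ->
  foldr (fun j r => iter (e j) (g j) r) q s = 'X_[\sum_(j <- s) U_(j) *+ e j] * q
  /\ dvanish K ('X_[\sum_(j <- s) U_(j) *+ e j] * q).
Proof.
move=> Ks gX qK; elim: s Ks => [|j s IH] Ks /=.
  by rewrite big_nil mpolyX0 mul1r.
have [|-> rK] := IH; first by move=> i si; apply: Ks; rewrite inE si orbT.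
rewrite big_cons mpolyXD -mulrA; split; last first.
  by apply: dvanish_mulX rK; apply: Ks; rewrite mem_head.
elim: (e j) => [|k IHk] /=; first by rewrite mulm0n mpolyX0 mul1r.
rewrite IHk gX; first by rewrite mulmS mpolyXD mulrA.
by apply: dvanish_mulX rK; apply: Ks; rewrite mem_head.
Qed.

Lemma foldr_mulX_all (g : 'I_(n + n) -> V -> V) (e : 'I_(n + n) -> nat) s q :
  (forall j q, j \in s -> g j q = 'X_j * q) ->
  foldr (fun j r => iter (e j) (g j) r) q s = 'X_[\sum_(j <- s) U_(j) *+ e j] * q.
Proof.
elim: s => [|j s IH] gX /=; first by rewrite big_nil mpolyX0 mul1r.
rewrite IH => [|i r si]; last by apply: gX; rewrite inE si orbT.
rewrite big_cons mpolyXD -mulrA.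
elim: (e j) => [|k IHk] /=; first by rewrite mulm0n mpolyX0 mul1r.
by rewrite IHk gX ?mem_head // mulmS mpolyXD mulrA.
Qed.

Lemma sum_ord_enum m s : perm_eq s (ord_enum (n + n)) ->
  (\sum_(j <- s) U_(j) *+ m j)%MM = m.
Proof.
move=> ps; rewrite [RHS]multinomUE_id; apply: perm_big.
apply: perm_trans ps _; apply: uniq_perm; rewrite ?ord_enum_uniq ?index_enum_uniq //.
by move=> i; rewrite mem_ord_enum mem_index_enum.
Qed.

Lemma wL_lshift (i : 'I_n) q : wL (lshift n i) q = 'X_(lshift n i) * q.
Proof. by rewrite /wL -[lshift n i]/(unsplit (inl i)) unsplitK. Qed.

Lemma wL_rshift (i : 'I_n) q :
  wL (rshift n i) q = 'X_(rshift n i) * q - mderiv (lshift n i) q.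
Proof. by rewrite /wL -[rshift n i]/(unsplit (inr i)) unsplitK. Qed.

Lemma wR_lshift (i : 'I_n) q :
  wR (lshift n i) q = 'X_(lshift n i) * q - mderiv (rshift n i) q.
Proof. by rewrite /wR -[lshift n i]/(unsplit (inl i)) unsplitK. Qed.

Lemma wR_rshift (i : 'I_n) q : wR (rshift n i) q = 'X_(rshift n i) * q.
Proof. by rewrite /wR -[rshift n i]/(unsplit (inr i)) unsplitK. Qed.

Lemma dvanish1 K : dvanish K 1.
Proof. by move=> i; rewrite -mpolyC1 mderivC. Qed.

(** The operators of the second half act first, when no variable of the first half is present to be
    differentiated. *)
Lemma wLm1 m : wLm m 1 = 'X_[m].
Proof.
rewrite /wLm ord_enum_split foldr_cat.
have [|j q jK|->] := @foldr_mulX wL (lshift n) m (map (@rshift n n) (ord_enum n)) 1 _ _ (dvanish1 _).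
- by move=> _ /mapP[i _ ->] i'; rewrite eq_lrshift.
- by case: (split_ordP j) => i ->; rewrite ?wL_lshift ?wL_rshift ?jK ?subr0.
move=> _; rewrite foldr_mulX_all; last by move=> _ q /mapP[i _ ->]; rewrite wL_lshift.
by rewrite mulr1 -mpolyXD -big_cat -ord_enum_split sum_ord_enum.
Qed.

Lemma wRm1 m : wRm m 1 = 'X_[m].
Proof.
rewrite /wRm ord_enum_split rev_cat foldr_cat.
have [|j q jK|->] := @foldr_mulX wR (@rshift n n) m (rev (map (lshift n) (ord_enum n))) 1 _ _ (dvanish1 _).
- by move=> j; rewrite mem_rev => /mapP[i _ ->] i'; rewrite eq_rlshift.
- by case: (split_ordP j) => i ->; rewrite ?wR_lshift ?wR_rshift ?jK ?subr0.
move=> _; rewrite foldr_mulX_all; last first.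
  by move=> j q; rewrite mem_rev => /mapP[i _ ->]; rewrite wR_rshift.
by rewrite mulr1 -mpolyXD -big_cat -rev_cat -ord_enum_split sum_ord_enum // perm_rev.
Qed.

(** Counterpart of [weylmul] over any commutative ring; the two are identified over fields in
    [weylmulE]. *)
Definition wmul a b : V := \sum_(m <- msupp a) a@_m *: wLm m b.

Lemma wmulE k a b : (msize a <= k)%N ->
  wmul a b = \sum_(h : bmultinom (n + n) k) a@_h *: wLm h b.
Proof.
move=> le_ak; set I : subFinType _ := bmultinom (n + n) k.
rewrite /wmul (big_mksub I) ?msupp_uniq //=; last first.
  by move=> x /msize_mdeg_lt /leq_trans; apply.
by rewrite big_rmcond //= => j /memN_msupp_eq0 ->; rewrite scale0r.
Qed.

Lemma wmul_linl b : linear (wmul ^~ b).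
Proof.
move=> c p q /=; pose k := maxn (msize (c *: p + q)) (maxn (msize p) (msize q)).
rewrite !(@wmulE k) ?leq_max ?leqnn ?orbT // scaler_sumr -big_split /=.
by apply: eq_bigr => m _; rewrite mcoeffD mcoeffZ scalerDl scalerA.
Qed.

Lemma wmul_linr a : linear (wmul a).
Proof.
move=> c p q; rewrite /wmul scaler_sumr -big_split /=; apply: eq_bigr => m _.
by rewrite linearP scalerDr !scalerA mulrC.
Qed.

Lemma wmulX m b : wmul 'X_[m] b = wLm m b.
Proof. by rewrite /wmul msuppX big_seq1 mcoeffX eqxx scale1r. Qed.

Lemma wmulm1 a : wmul a 1 = a.
Proof. by rewrite /wmul [RHS]mpolyE; apply: eq_bigr => m _; rewrite wLm1. Qed.

Lemma wmul1m a : wmul 1 a = a.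
Proof.
rewrite -mpolyX0 wmulX /wLm; elim: (ord_enum _) => //= j s ->.
by rewrite mnm0E.
Qed.

Lemma wmul_wRm a m b : wmul a (wRm m b) = wRm m (wmul a b).
Proof.
by rewrite /wmul linear_sum; apply: eq_bigr => m' _; rewrite linearZ wLRm_comm.
Qed.

(* The left operators commute with the right ones, and the latter reach every [b]
   from [1]. *)
Lemma wmulA : associative wmul.
Proof.
move=> a b c; rewrite [c]mpolyE.
elim: (msupp c) => [|m s IH].
  rewrite !big_nil.
  have w0 x : wmul x 0 = 0.
    by have := wmul_linr x (-1) 0 0; rewrite scaler0 addr0 scaleN1r addrC subrr.
  by rewrite !w0.
rewrite !big_cons !wmul_linr IH; congr (_ *: _ + _).
by rewrite -wRm1 !wmul_wRm !wmulm1.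
Qed.

End Operators.

(* Convertible to [{mpoly R[n + n]}], but carrying the Weyl product. *)
Definition weylR (n : nat) (R : comNzRingType) := {mpoly R[n + n]}.

HB.instance Definition _ (n : nat) (R : comNzRingType) :=
  GRing.Lmodule.copy (weylR n R) {mpoly R[n + n]}.

Section WeylRing.
Variables (n : nat) (R : comNzRingType).
Local Notation W := (weylR n R).
Local Notation V := {mpoly R[n + n]}.

Lemma wmulDl : left_distributive (@wmul n R) +%R.
Proof. by move=> a b c; have := wmul_linl c 1 a b; rewrite /= !scale1r. Qed.
Lemma wmulDr : right_distributive (@wmul n R) +%R.
Proof. by move=> a b c; have := wmul_linr a 1 b c; rewrite !scale1r. Qed.
Lemma wone_neq0 : (1 : V) != 0. Proof. exact: oner_neq0. Qed.

HB.instance Definition _ := GRing.Zmodule_isNzRing.Build W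
  (@wmulA n R) (@wmul1m n R) (@wmulm1 n R) wmulDl wmulDr wone_neq0.

Lemma wmulZl (c : R) (a b : V) : c *: wmul a b = wmul (c *: a) b.
Proof.
have /(_ c a 0) := @wmul_linl n R b.
have w0 : wmul 0 b = 0 by rewrite /wmul msupp0 big_nil.
by rewrite /= w0 !addr0.
Qed.
HB.instance Definition _ := GRing.Lmodule_isLalgebra.Build R W wmulZl.

Lemma wmulZr (c : R) (a b : V) : c *: wmul a b = wmul a (c *: b).
Proof.
have /(_ c b 0) := @wmul_linr n R a.
by rewrite !addr0 (mulr0 (a : W) : wmul a 0 = 0) addr0.
Qed.
HB.instance Definition _ := GRing.Lalgebra_isAlgebra.Build R W wmulZr.

Definition wY (j : 'I_(n + n)) : W := 'X_j : V.

Lemma wY_mul j (q : W) : wY j * q = wL j q.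
Proof.
rewrite -[LHS]/(wmul 'X_[U_(j)] q) wmulX /wLm.
have : j \in ord_enum (n + n) by rewrite mem_ord_enum.
have := ord_enum_uniq (n + n); elim: (ord_enum _) => //= i s IH /andP[i_s us].
rewrite inE; case: (eqVneq j i) i_s => [<- j_s _|ji i_s js].
  rewrite mnm1E eqxx /=; congr wL; elim: s j_s {IH us} => //= k s IH.
  by rewrite inE negb_or => /andP[ji js]; rewrite IH // mnm1E (negPf ji).
by rewrite mnm1E (negPf ji) /= IH.
Qed.

Lemma wY_mulr j (q : W) : q * wY j = wR j q.
Proof.
have e : wY j = wR j 1.
  by case: (split_ordP j) => i ->; rewrite ?wR_lshift ?wR_rshift mulr1 // dvanish1 subr0.
rewrite e -[LHS]/(wmul q (wR j 1)) -[RHS]/(wR j q).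
rewrite -[in RHS](wmulm1 q) /wmul linear_sum; apply: eq_bigr => m _.
rewrite linearZ; congr (_ *: _); rewrite /wLm; symmetry.
by apply: foldr_iter_comm => k y; rewrite wLR_comm.
Qed.

Lemma wcommY_lshift (i : 'I_n) (q : W) :
  wY (lshift n i) * q - q * wY (lshift n i) = mderiv (rshift n i) (q : V).
Proof. by rewrite wY_mul wY_mulr wL_lshift wR_lshift opprB addrCA subrr addr0. Qed.

Lemma wcommY_rshift (i : 'I_n) (q : W) :
  wY (rshift n i) * q - q * wY (rshift n i) = - mderiv (lshift n i) (q : V).
Proof. by rewrite wY_mul wY_mulr wL_rshift wR_rshift addrAC subrr add0r. Qed.

End WeylRing.

(** * Homomorphisms from the Weyl algebra *)

Section OrderedProducts.
Variables (I : eqType) (S : nzRingType) (u : I -> S).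
Hypothesis uC : forall i k, GRing.comm (u i) (u k).

Lemma prod_comm_insert (e : I -> nat) (s : seq I) (i : I) : uniq s -> i \in s ->
  \prod_(k <- s) u k ^+ ((i == k) + e k) = u i * \prod_(k <- s) u k ^+ e k.
Proof.
elim: s => // k s IH /= /andP[ks us]; rewrite inE !big_cons.
case: (eqVneq i k) ks => [<- is_ _|ik _ /= iss].
  rewrite add1n exprS -mulrA; congr (_ * (_ * _)).
  apply: eq_big_seq => l ls; case: eqP => // il; by rewrite il ls in is_.
by rewrite add0n IH // !mulrA; congr (_ * _); symmetry; apply: commrX; apply: uC.
Qed.

Variables (w : S) (i : I).
Hypothesis wu : forall k, w * u k = u k * w - (i == k)%:R.

(** The commutator with [w] is a derivation, namely minus the partial derivative with respect to
    [u i]. *)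
Lemma comm_exp_deriv (k : I) (e : nat) :
  w * u k ^+ e = u k ^+ e * w - u k ^+ e.-1 *+ (e * (i == k)).
Proof.
elim: e => [|e IH]; first by rewrite !expr0 mul1r mulr1 subr0.
rewrite exprSr mulrA IH mulrBl -[_ * w * _]mulrA wu mulrBr mulrA -addrA; congr (_ + _).
rewrite -opprD; congr (- _); case: eqP => _; last by rewrite !muln0 mulr0 mulr0n mul0r addr0.
rewrite mulr1 !muln1 mulrS mulrnAl; case: e {IH} => [|e]; first by rewrite !mulr0n.
by rewrite -exprSr.
Qed.

Lemma prod_comm_deriv (e : I -> nat) (s : seq I) : uniq s -> i \in s ->
  w * \prod_(k <- s) u k ^+ e k = (\prod_(k <- s) u k ^+ e k) * w
    - (\prod_(k <- s) u k ^+ (e k - (i == k))) *+ e i.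
Proof.
have no t : i \notin t -> w * \prod_(k <- t) u k ^+ e k = (\prod_(k <- t) u k ^+ e k) * w.
  elim: t => [|k t IH]; first by rewrite big_nil mulr1 mul1r.
  rewrite inE negb_or big_cons => /andP[/negPf ik /IH it].
  by rewrite mulrA comm_exp_deriv ik muln0 mulr0n subr0 -mulrA it mulrA.
elim: s => // k s IH /= /andP[ks us]; rewrite inE !big_cons.
case: (eqVneq i k) ks => [<- is_ _|ik _ /= iss].
  rewrite mulrA comm_exp_deriv eqxx muln1 mulrBl -[_ * w * _]mulrA no // mulrA; congr (_ - _).
  rewrite subn1 -mulrnAl; congr (_ * _).
  apply: eq_big_seq => l ls; case: eqP => [il|_]; last by rewrite subn0.
  by rewrite il ls in is_.
rewrite mulrA comm_exp_deriv (negPf ik) muln0 mulr0n !subr0 -[_ * w * _]mulrA IH // mulrBr mulrA mulrnAr.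
by rewrite subn0.
Qed.

End OrderedProducts.

Section Universal.
Variables (n : nat).

(** Matrix of the standard symplectic form, which gathers all the Weyl relations into one
    formula. *)
Definition womega (S : nzRingType) (i j : 'I_(n + n)) : S :=
  (j == (i + n)%N :> nat)%:R - (i == (j + n)%N :> nat)%:R.

Definition wrel (S : nzRingType) (z : 'I_(n + n) -> S) : Prop :=
  forall i j, z i * z j - z j * z i = womega S i j.

Variables (R : comNzRingType) (S : nzRingType) (theta : {rmorphism R -> S}).
Variable z : 'I_(n + n) -> S.
Hypothesis zrel : wrel z.
Hypothesis thetaz : forall c j, theta c * z j = z j * theta c.
Local Notation W := (weylR n R).
Local Notation V := {mpoly R[n + n]}.

(** [mmap] sends ordered basis monomials to ordered products, so it makes sense for a noncommutative
    target and turns out multiplicative for the Weyl product. The coefficient map [theta] is general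
    because it will later embed the scalars, the centre, or polynomials over the centre. *)
Definition wev : W -> S := mmap theta z.

Lemma womega_ll (i j : 'I_n) : womega S (lshift n i) (lshift n j) = 0.
Proof. by rewrite /womega /= !ltn_eqF ?subrr // ltn_addl. Qed.
Lemma womega_rr (i j : 'I_n) : womega S (rshift n i) (rshift n j) = 0.
Proof.
by rewrite /womega /= !(addnC n) !eqn_add2r !ltn_eqF ?subrr // ltn_addl.
Qed.
Lemma womega_rl (i j : 'I_n) : womega S (rshift n i) (lshift n j) = - (i == j)%:R.
Proof.
rewrite /womega /= ltn_eqF ?(addnC n i) ?eqn_add2r ?sub0r //.
by rewrite -addnA (leq_trans (ltn_ord j)) // addnCA leq_addr.
Qed.

Lemma zcomm i j : womega S i j = 0 -> GRing.comm (z i) (z j).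
Proof. by move=> w0; apply/eqP; rewrite -subr_eq0 zrel w0. Qed.

Lemma mmap1_split m : mmap1 z m =
  (\prod_(i < n) z (lshift n i) ^+ m (lshift n i)) *
  (\prod_(i < n) z (rshift n i) ^+ m (rshift n i)).
Proof. by rewrite /mmap1 big_split_ord. Qed.

Lemma wevX m : wev 'X_[m] = mmap1 z m.
Proof. exact: mmapX. Qed.

Lemma wevZ c (q : V) : wev (c *: q) = theta c * wev q.
Proof. exact: mmapZ. Qed.

Lemma wev_is_additive : zmod_morphism wev.
Proof. exact: (raddfB (mmap theta z)). Qed.
HB.instance Definition _ := GRing.isZmodMorphism.Build W S wev wev_is_additive.

Lemma wev_wL j (q : V) : wev (wL j q) = z j * wev q.
Proof.
rewrite [q]mpolyE linear_sum !raddf_sum mulr_sumr; apply: eq_bigr => m _.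
rewrite linearZ /= !wevZ mulrA -thetaz -mulrA; congr (_ * _).
rewrite wevX; case: (split_ordP j) => i ->.
  rewrite wL_lshift -mpolyXD wevX !mmap1_split mulrA; congr (_ * _).
    under eq_bigr => k _ do rewrite mnmDE mnm1E eq_lshift.
    apply: (@prod_comm_insert _ _ (fun k => z (lshift n k)) _ (fun k => m (lshift n k))) => [k l||].
    - exact/zcomm/womega_ll.
    - exact: index_enum_uniq.
    - exact: mem_index_enum.
  by apply: eq_bigr => k _; rewrite mnmDE mnm1E eq_lrshift.
rewrite wL_rshift -mpolyXD mderivX raddfB /= wevZ !wevX !mmap1_split [in RHS]mulrA.
rewrite rmorph_nat mulr_natl.
(* Moving [z (rshift n i)] past the first block costs a derivative, which is the correction term of
   [wL_rshift]. *)
have -> : z (rshift n i) * (\prod_(k < n) z (lshift n k) ^+ m (lshift n k)) =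
    (\prod_(k < n) z (lshift n k) ^+ m (lshift n k)) * z (rshift n i)
    - (\prod_(k < n) z (lshift n k) ^+ (m (lshift n k) - (i == k))) *+ m (lshift n i).
  apply: (@prod_comm_deriv _ _ (fun k => z (lshift n k)) _ i _ (fun k => m (lshift n k))).
  - move=> k; apply/eqP; rewrite eq_sym subr_eq addrC -subr_eq; apply/eqP.
    by rewrite -[LHS]opprB zrel womega_rl opprK.
  - exact: index_enum_uniq.
  - exact: mem_index_enum.
rewrite mulrBl -[in RHS]mulrA; congr (_ - _).
  congr (_ * _); first by apply: eq_bigr => k _; rewrite mnmDE mnm1E eq_rlshift.
  under eq_bigr => k _ do rewrite mnmDE mnm1E eq_rshift.
  apply: (@prod_comm_insert _ _ (fun k => z (rshift n k)) _ (fun k => m (rshift n k))) => [k l||].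
  - exact/zcomm/womega_rr.
  - exact: index_enum_uniq.
  - exact: mem_index_enum.
rewrite mulrnAl; congr (_ * _ *+ _); apply: eq_bigr => k _; rewrite mnmBE mnm1E.
  by rewrite eq_lshift.
by rewrite eq_lrshift subn0.
Qed.

Lemma wev_wLm m (q : V) : wev (wLm m q) = mmap1 z m * wev q.
Proof.
rewrite /wLm /mmap1.
have pe : \prod_(i < n + n) z i ^+ m i = \prod_(i <- ord_enum (n + n)) z i ^+ m i.
  by congr bigop; rewrite /index_enum 2!unlock.
rewrite pe; elim: (ord_enum _) => [|j s IH] /=; first by rewrite big_nil mul1r.
rewrite big_cons -mulrA -IH; elim: (m j) => [|k IHk] /=; first by rewrite mul1r.
by rewrite wev_wL IHk exprS mulrA.
Qed.

Lemma wev_is_multiplicative : monoid_morphism wev.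
Proof.
split; first by rewrite -[1]mpolyX0 wevX mmap11.
move=> a b; rewrite -[a * b]/(wmul a b) /wmul raddf_sum /= {2}/wev /mmap mulr_suml.
apply: eq_bigr => m _; rewrite wevZ wev_wLm mulrA //.
Qed.
HB.instance Definition _ := GRing.isMonoidMorphism.Build W S wev wev_is_multiplicative.

End Universal.

Lemma msize_leP (n : nat) (R : nzRingType) (q : {mpoly R[n]}) (k : nat) :
  (forall m, m \in msupp q -> (mdeg m < k)%N) <-> (msize q <= k)%N.
Proof.
split=> [h|h m /msize_mdeg_lt /leq_trans]; last exact.
by rewrite msizeE big_seq; elim/big_ind: _ => // x y; rewrite geq_max => -> ->.
Qed.

Lemma msize_mderiv (n : nat) (R : nzRingType) (q : {mpoly R[n]}) i :
  (msize (mderiv i q) <= (msize q).-1)%N.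
Proof.
apply/msize_leP => m; rewrite mcoeff_msupp mcoeff_deriv => nz.
have : (m + U_(i))%MM \in msupp q.
  by rewrite mcoeff_msupp; apply: contraNneq nz => ->; rewrite mul0rn.
by move/msize_mdeg_lt; rewrite mdegD mdeg1 addn1; case: (msize q).
Qed.

Section Generators.
Variables (n : nat) (R : comNzRingType).
Local Notation W := (weylR n R).
Local Notation V := {mpoly R[n + n]}.
Local Notation Y := (@wY n R).

Lemma wY_rel : wrel Y.
Proof.
move=> i j; case: (split_ordP i) => k ->.
  rewrite wcommY_lshift /wY mderivXU /womega /= -val_eqE /=.
  rewrite [_ == (_ + _)%N :> nat in X in _ - X]ltn_eqF; last by rewrite ltn_addl.
  by rewrite subr0 eq_sym addnC.
rewrite wcommY_rshift /wY mderivXU /womega /= -val_eqE /=.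
rewrite [_ == (_ + _)%N :> nat in X in X - _]ltn_eqF; last first.
  by rewrite -addnA (leq_trans (ltn_ord j)) // leq_add2l leq_addl.
by rewrite sub0r addnC eqn_add2r.
Qed.

Lemma wLm_prod m (q : W) : wLm m q = mmap1 Y m * q.
Proof.
rewrite /wLm /mmap1.
have -> : \prod_(i < n + n) Y i ^+ m i = \prod_(i <- ord_enum (n + n)) Y i ^+ m i.
  by congr bigop; rewrite /index_enum 2!unlock.
elim: (ord_enum _) => [|j s IH] /=; first by rewrite big_nil mul1r.
rewrite big_cons -mulrA -IH; elim: (m j) => [|k IHk] /=; first by rewrite mul1r.
by rewrite IHk -wY_mul exprS mulrA.
Qed.

Lemma mmap1_wY m : mmap1 Y m = ('X_[m] : V).
Proof. by rewrite -(wLm1 R m) (wLm_prod m 1) mulr1. Qed.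

Lemma wbasisE (a : W) : a = \sum_(m <- msupp (a : V)) (a : V)@_m *: mmap1 Y m.
Proof. by rewrite [LHS]mpolyE; apply: eq_bigr => m _; rewrite mmap1_wY. Qed.

Lemma wY_ind (P : W -> Prop) : P 0 -> P 1 ->
  (forall c a b, P a -> P b -> P (c *: a + b)) ->
  (forall j a, P a -> P (Y j * a)) -> forall a, P a.
Proof.
move=> P0 P1 Pl PY a; rewrite (wbasisE a); elim: (msupp _) => [|m s IH].
  by rewrite big_nil.
rewrite big_cons; apply: Pl IH; rewrite -[mmap1 Y m]mulr1 -wLm_prod /wLm.
elim: (ord_enum _) => //= j t IH; elim: (m j) => //= k.
by move=> /(PY j); rewrite wY_mul.
Qed.

Lemma wcentral_alg (c : R) (a : W) : c%:A * a = a * c%:A.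
Proof. by rewrite mulr_algl mulr_algr. Qed.

End Generators.

Section Evaluation.
Variables (n : nat) (R : comNzRingType) (S : nzRingType) (theta : {rmorphism R -> S}).
Variable z : 'I_(n + n) -> S.
Hypothesis zrel : wrel z.
Hypothesis thetaz : forall c j, theta c * z j = z j * theta c.
Local Notation W := (weylR n R).
Local Notation V := {mpoly R[n + n]}.
Local Notation ev := (@wev n R S theta z).

Lemma wevY j : ev (wY R j) = z j.
Proof. by rewrite wevX mmap1U. Qed.

Lemma wevM (a b : W) : ev (a * b) = ev a * ev b.
Proof. by have [_ ->] := wev_is_multiplicative zrel thetaz. Qed.

Lemma wev_deriv_r (i : 'I_n) (f : V) :
  ev (mderiv (rshift n i) f) = z (lshift n i) * ev f - ev f * z (lshift n i).
Proof. by rewrite -wcommY_lshift raddfB /= !wevM wevY. Qed.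

Lemma wev_deriv_l (i : 'I_n) (f : V) :
  ev (- mderiv (lshift n i) f) = z (rshift n i) * ev f - ev f * z (rshift n i).
Proof. by rewrite -wcommY_rshift raddfB /= !wevM wevY. Qed.

(* Bracketing with the [z j] differentiates a relation, so all its non-constant
   coefficients vanish by descent on the degree. *)
Lemma wev_independent (f : V) :
  (forall m, m \in msupp f -> forall i k, (0 < k <= m i)%N -> forall x : S, x *+ k = 0 -> x = 0) ->
  ev f = 0 -> forall m, theta f@_m = 0.
Proof.
move: {2}(msize f) (leqnn (msize f)) => b; elim: b f => [|b IH] f.
  by rewrite leqn0 msize_poly_eq0 => /eqP -> _ _ m; rewrite mcoeff0 rmorph0.
move=> fb inj evf.
have der j m : theta f@_(m + U_(j)) = 0.
  have evd : ev (mderiv j f) = 0.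
    case: (split_ordP j) => i ->; first apply: oppr_inj.
      by rewrite -raddfN /= wev_deriv_l evf mulr0 mul0r subrr oppr0.
    by rewrite wev_deriv_r evf mulr0 mul0r subrr.
  have supp_d m' : m' \in msupp (mderiv j f) -> (m' + U_(j))%MM \in msupp f.
    rewrite !mcoeff_msupp mcoeff_deriv; apply: contraNneq => ->.
    by rewrite mul0rn.
  have h : theta (mderiv j f)@_m = 0.
    apply: IH evd m => [|m' /supp_d m'f i k /andP[k0 km]].
      by rewrite (leq_trans (msize_mderiv _ _)) //; case: (msize f) fb.
    by apply: (inj _ m'f i); rewrite k0 mnmDE (leq_trans km) ?leq_addr.
  move: h; rewrite mcoeff_deriv raddfMn /= => h.
  have [mf|/memN_msupp_eq0 ->] := boolP ((m + U_(j))%MM \in msupp f); last exact: rmorph0.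
  by apply: (inj _ mf j (m j).+1); rewrite // mnmDE mnm1E eqxx addn1 leqnn.
have pos m : m != 0%MM -> theta f@_m = 0.
  move=> m0; suff [j mj] : exists j, m j != 0%N.
    by rewrite -(submK (m := U_(j)) (m' := m)) // lep1mP.
  apply/existsP; apply: contraNT m0; rewrite negb_exists => /forallP h.
  by apply/eqP/mnmP => j; rewrite mnm0E; apply/eqP; have := h j; rewrite negbK.
move=> m; have [->|/pos //] := eqVneq m 0%MM.
have [f0|/memN_msupp_eq0 ->] := boolP (0%MM \in msupp f); last exact: rmorph0.
rewrite -evf /wev /mmap (bigD1_seq 0%MM) ?msupp_uniq //= mmap11 mulr1 big1 ?addr0 //.
by move=> m' /pos ->; rewrite mul0r.
Qed.

End Evaluation.

(** * Change of coefficients *)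

Section Functoriality.
Variables (n : nat) (R R' : comNzRingType) (f : {rmorphism R -> R'}).

Definition wmap : weylR n R -> weylR n R' := map_mpoly f.

(** Presents the change of coefficients as an evaluation at the generators, from which its
    multiplicativity is inherited. *)
Lemma wmap_wev a : wmap a = wev (in_alg (weylR n R') \o f) (@wY n R') a.
Proof.
rewrite /wmap /map_mpoly /wev /mmap; apply: eq_bigr => m _ /=.
rewrite mulr_algl mmap1_wY mmap1_id mul_mpolyC.
by [].
Qed.

Lemma wmap_is_additive : zmod_morphism wmap.
Proof. exact: raddfB. Qed.
HB.instance Definition _ := GRing.isZmodMorphism.Build _ _ wmap wmap_is_additive.

Lemma wmap_is_multiplicative : monoid_morphism wmap.
Proof.
have [e1 eM] := @wev_is_multiplicative n R _ (in_alg (weylR n R') \o f) _ (@wY_rel n R')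
  (fun c j => wcentral_alg _ _).
by split=> [|a b]; rewrite !wmap_wev.
Qed.
HB.instance Definition _ := GRing.isMonoidMorphism.Build _ _ wmap wmap_is_multiplicative.

Lemma wmapZ c a : wmap (c *: a) = f c *: wmap a.
Proof. exact: map_mpolyZ. Qed.

Lemma wmapY j : wmap (wY R j) = wY R' j.
Proof. exact: map_mpolyX. Qed.

Lemma mcoeff_wmap a m : (wmap a : {mpoly _[_]})@_m = f (a : {mpoly _[_]})@_m.
Proof. exact: mcoeff_map_mpoly. Qed.

End Functoriality.

Section Endomorphism.
Variables (n : nat) (R : comNzRingType).
Local Notation W := (weylR n R).

Definition wendo (z : 'I_(n + n) -> W) : W -> W := wev (in_alg W) z.

Implicit Type z : 'I_(n + n) -> W.

Lemma wendoD z a b : wendo z (a + b) = wendo z a + wendo z b.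
Proof. exact: raddfD. Qed.

Lemma wendoZ z c a : wendo z (c *: a) = c *: wendo z a.
Proof. by rewrite /wendo wevZ mulr_algl. Qed.

Lemma wendoX z m : wendo z 'X_[m] = mmap1 z m.
Proof. exact: wevX. Qed.

Lemma wendoY z j : wendo z (wY R j) = z j.
Proof. exact: wevY. Qed.

Lemma wendoM z : wrel z -> {morph wendo z : a b / a * b}.
Proof. by move=> zr a b; apply: wevM => // c j; apply: wcentral_alg. Qed.

Lemma wendo1 z : wendo z 1 = 1.
Proof. by rewrite -[X in wendo z X]mpolyX0 wendoX mmap11. Qed.

Lemma wendoXn z (a : W) k : wrel z -> wendo z (a ^+ k) = wendo z a ^+ k.
Proof.
move=> zr; elim: k => [|k IH]; first by rewrite !expr0 wendo1.
by rewrite !exprS wendoM // IH.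
Qed.

Lemma wendo_sum z (I : Type) (s : seq I) (P : pred I) (F : I -> W) :
  wendo z (\sum_(i <- s | P i) F i) = \sum_(i <- s | P i) wendo z (F i).
Proof. exact: raddf_sum. Qed.

Lemma wendoN z a : wendo z (- a) = - wendo z a.
Proof. exact: raddfN. Qed.

Lemma wendo0 z : wendo z 0 = 0.
Proof. exact: raddf0. Qed.

Lemma wendo_wY (a : W) : wendo (@wY n R) a = a.
Proof.
rewrite {2}[a]wbasisE /wendo /wev /mmap; apply: eq_bigr => m _.
by rewrite mulr_algl.
Qed.

Lemma wendo_comp z (g : 'I_(n + n) -> W) a : wrel g ->
  wendo g (wendo z a) = wendo (wendo g \o z) a.
Proof.
move=> gr; elim/mpolyind: a => [|c m p _ _ IH]; first by rewrite /wendo !raddf0.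
rewrite !wendoD IH !wendoZ !wendoX; congr (_ *: _ + _).
rewrite /mmap1; elim/big_rec2: _ => [|i x a _ <-]; first exact: wendo1.
by rewrite wendoM // wendoXn.
Qed.

Lemma wendoK z (g : 'I_(n + n) -> W) a : wrel g -> (forall j, wendo g (z j) = wY R j) ->
  wendo g (wendo z a) = a.
Proof.
move=> gr gz; rewrite wendo_comp // -[RHS]wendo_wY /wendo /wev /mmap.
apply: eq_bigr => m _; congr (_ * _); rewrite /mmap1; apply: eq_bigr => i _.
by rewrite -gz.
Qed.

End Endomorphism.

Lemma wmap_wendo (n : nat) (R R' : comNzRingType) (f : {rmorphism R -> R'}) z a :
  wmap f (@wendo n R z a) = wendo (wmap f \o z) (wmap f a).
Proof.
have wmapD (p q : weylR n R) : wmap f (p + q) = wmap f p + wmap f q by apply: raddfD.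
elim/mpolyind: a => [|c m p _ _ IH].
  by rewrite /wendo /= [wmap f 0]raddf0 !raddf0.
rewrite wmapD !wendoD wmapD IH; congr (_ + _).
rewrite wmapZ !wendoZ wmapZ [wmap f 'X_[m]]map_mpolyX !wendoX.
by congr (_ *: _); rewrite /mmap1 rmorph_prod; apply: eq_bigr => i _; rewrite rmorphXn.
Qed.

(** * Degrees *)

Section Bridge.
Variables (n : nat) (K : fieldType).
Local Notation W := (weylR n K).
Local Notation V := {mpoly K[n + n]}.

Lemma bumpmE (m : 'X_{1..n + n}) j : bumpm m j = (m + U_(j))%MM.
Proof. by apply/mnmP => i; rewrite !mnmE eq_sym. Qed.

Lemma dropmE (m : 'X_{1..n + n}) j : dropm m j = (m - U_(j))%MM.
Proof. by apply/mnmP => i; rewrite !mnmE eq_sym. Qed.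

Lemma lmulYE j (q : weyl n K) : lmulY j q = wL j q.
Proof.
rewrite /lmulY [in RHS](mpolyE q) linear_sum; apply: eq_bigr => m _.
rewrite linearZ /=; congr (_ *: _); rewrite /lmulY_mon /wL.
case: splitP => i _; rewrite /wmon bumpmE mpolyXD mulrC //.
by rewrite dropmE mderivX.
Qed.

Lemma weylmulE (a b : weyl n K) : weylmul a b = (a : W) * b.
Proof.
rewrite -[RHS]/(wmul a b) /weylmul /wmul; apply: eq_bigr => m _; congr (_ *: _).
rewrite /wLm; elim: (ord_enum _) => //= j s ->.
by apply: eq_iter => q; rewrite lmulYE.
Qed.

Lemma YgenE (j : 'I_(n + n)) : Ygen K j = wY K j.
Proof. by rewrite /Ygen /wmon bumpmE add0m. Qed.

Lemma weyloneE : weylone n K = 1 :> W.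
Proof. exact: mpolyX0. Qed.

Lemma wexpE (a : weyl n K) k : wexp a k = (a : W) ^+ k.
Proof. by elim: k => [|k IH]; [exact: weyloneE | rewrite exprS -IH -weylmulE]. Qed.

Definition wimages (phi : weyl n K -> weyl n K) : 'I_(n + n) -> W := phi \o @wY n K.

(** Together with [wendo_is_endo], this replaces endomorphisms by the finite families of images of
    the generators. *)
Lemma is_weyl_endoP (phi : weyl n K -> weyl n K) : is_weyl_endo phi ->
  wrel (wimages phi) /\ phi =1 wendo (wimages phi).
Proof.
case=> phiD phiZ phiM phi1.
have phiM' (a b : W) : phi (a * b) = (phi a : W) * phi b by rewrite -!weylmulE phiM.
have phi0 : phi 0 = 0 by have := phiZ 0 0; rewrite !scale0r.
have phiB (a b : W) : phi (a - b) = (phi a : W) - phi b.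
  by rewrite phiD -scaleN1r phiZ scaleN1r.
have phi1' : phi (1 : W) = (1 : W) by rewrite -weyloneE; exact: phi1.
split.
  move=> i j; rewrite /wimages /= -!phiM' -phiB wY_rel /womega.
  have phin k : phi k%:R = (k%:R : W).
    elim: k => [|k IH]; first by rewrite !mulr0n.
    by rewrite !mulrS phiD IH phi1'.
  by rewrite phiB !phin.
have phiE (a : W) k : phi (a ^+ k) = (phi a : W) ^+ k.
  by elim: k => [|k IH]; [exact: phi1' | rewrite !exprS phiM' IH].
have phiX (m : 'X_{1..n + n}) : phi 'X_[m] = mmap1 (wimages phi) m.
  rewrite -mmap1_wY /mmap1; elim/big_rec2: _ => [|i a b _ <-]; first exact: phi1'.
  by rewrite phiM' phiE.
move=> a; rewrite [a in LHS]mpolyE [a in RHS]mpolyE.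
elim: (msupp a) => [|m s IH]; first by rewrite !big_nil phi0 [RHS]raddf0.
by rewrite !big_cons wendoD wendoZ wendoX phiD phiZ phiX IH.
Qed.

Lemma wendo_is_endo (z : 'I_(n + n) -> W) : wrel z -> is_weyl_endo (wendo z : weyl n K -> weyl n K).
Proof.
move=> zr; split.
- exact: wendoD.
- exact: wendoZ.
- by move=> a b; rewrite !weylmulE wendoM.
- by rewrite weyloneE wendo1.
Qed.

Lemma wL_lead j (q : {mpoly K[n + n]}) : (msize (wL j q - 'X_j * q) <= (msize q).-1)%N.
Proof.
case: (split_ordP j) => i ->; first by rewrite wL_lshift subrr mmeasure0.
by rewrite wL_rshift addrAC subrr sub0r mmeasureN msize_mderiv.
Qed.

Lemma msizeM_leq (p q : {mpoly K[n + n]}) : (msize (p * q) <= (msize p + msize q).-1)%N.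
Proof.
have [->|p0] := eqVneq p 0; first by rewrite mul0r mmeasure0.
have [->|q0] := eqVneq q 0; first by rewrite mulr0 mmeasure0.
by rewrite msizeM.
Qed.

Lemma wL_size j (q : {mpoly K[n + n]}) : (msize (wL j q) <= (msize q).+1)%N.
Proof.
rewrite -[wL j q](subrK ('X_j * q)); apply: leq_trans (msizeD_le _ _) _.
rewrite geq_max (leq_trans (wL_lead j q)) /=; last by rewrite (leq_trans (leq_pred _)).
by rewrite (leq_trans (msizeM_leq _ _)) // msizeX mdeg1.
Qed.

(** Agreement of [q] and [r] in top degree is the invariant carried from one generator to the next
    in [wLm_lead]. *)
Lemma wL_iter_lead j k (q r : {mpoly K[n + n]}) (s : nat) :
  (msize r <= s)%N -> (msize (q - r) <= s.-1)%N ->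
  (msize (iter k (wL j) q - 'X_[U_(j) *+ k] * r) <= (k + s).-1)%N.
Proof.
move=> rs qrs; elim: k => [|k IH] /=; first by rewrite mulm0n mpolyX0 mul1r add0n.
set p := iter k _ q in IH *; set x := 'X_[_] * r in IH.
have -> : wL j p - 'X_[U_(j) *+ k.+1] * r = (wL j p - 'X_j * p) + 'X_j * (p - x).
  by rewrite mulmS mpolyXD -mulrA -/x mulrBr addrA subrK.
have xs : (msize x <= k + s)%N.
  by rewrite (leq_trans (msizeM_leq _ _)) // msizeX mdegMn mdeg1 mul1n addSn /= leq_add2l.
have ps : (msize p <= k + s)%N.
  rewrite -[p](subrK x); apply: leq_trans (msizeD_le _ _) _.
  by rewrite geq_max xs (leq_trans IH) ?leq_pred.
apply: leq_trans (msizeD_le _ _) _; rewrite geq_max; apply/andP; split.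
  by apply: leq_trans (wL_lead _ _) _; lia.
case: (eqVneq (p - x) 0) => [->|nz]; first by rewrite mulr0 mmeasure0.
apply: leq_trans (msizeM_leq _ _) _; rewrite msizeX mdeg1.
have : (0 < msize (p - x))%N by rewrite lt0n msize_poly_eq0.
by move: (msize _) IH => t; clear; lia.
Qed.

Lemma wLm_lead m (q : {mpoly K[n + n]}) :
  (msize (wLm m q - 'X_[m] * q) <= (mdeg m + msize q).-1)%N.
Proof.
suff h s : (msize (foldr (fun j r => iter (m j) (wL j) r) q s -
   'X_[\sum_(j <- s) U_(j) *+ m j] * q) <= (\sum_(j <- s) m j + msize q).-1)%N.
  have -> : mdeg m = (\sum_(j <- ord_enum (n + n)) m j)%N.
    by rewrite mdegE; congr bigop; rewrite /index_enum 2!unlock.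
  by rewrite -{2}(sum_ord_enum m (perm_refl _)); apply: h.
elim: s => [|j s IH] /=.
  by rewrite big_nil mpolyX0 mul1r subrr mmeasure0.
rewrite !big_cons mpolyXD -mulrA -addnA; apply: wL_iter_lead IH.
have [->|q0] := eqVneq q 0; first by rewrite mulr0 mmeasure0.
rewrite (leq_trans (msizeM_leq _ _)) // msizeX addSn /= leq_add2r.
by elim: s => [|i s IH]; rewrite !(big_nil, big_cons) ?mdeg0 // mdegD mdegMn mdeg1 mul1n leq_add2l.
Qed.

(* The Weyl and the commutative product differ in lower degree, so both products have the same
   leading form. *)
Lemma wmul_lead (a b : {mpoly K[n + n]}) :
  (msize (wmul a b - a * b) <= (msize a + msize b).-2)%N.
Proof.
have -> : wmul a b - a * b = \sum_(m <- msupp a) a@_m *: (wLm m b - 'X_[m] * b).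
  rewrite {2}[a]mpolyE mulr_suml -sumrB; apply: eq_bigr => m _.
  by rewrite scalerBr scalerAl.
rewrite big_seq; elim/big_ind: _ => [|x y xs ys|m ma]; first by rewrite mmeasure0.
  by rewrite (leq_trans (msizeD_le _ _)) // geq_max xs.
apply: leq_trans (mmeasureZ_le _ _ _) _; apply: leq_trans (wLm_lead _ _) _.
by have := msize_mdeg_lt ma; lia.
Qed.

Lemma wmsizeM (a b : W) : a != 0 -> b != 0 ->
  msize (a * b : {mpoly K[n + n]}) =
  (msize (a : {mpoly K[n + n]}) + msize (b : {mpoly K[n + n]})).-1.
Proof.
move=> a0 b0; rewrite -[a * b]/(wmul a b).
have := wmul_lead a b; have := msizeM a0 b0.
have sa : (0 < msize (a : V))%N by rewrite lt0n msize_poly_eq0.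
have sb : (0 < msize (b : V))%N by rewrite lt0n msize_poly_eq0.
set x := wmul a b; set y : V := (a : V) * (b : V) => sy xy.
have h1 : (msize x <= maxn (msize y) (msize (x - y)))%N.
  by have := msizeD_le y (x - y); rewrite addrC subrK.
have h2 : (msize y <= maxn (msize x) (msize (x - y)))%N.
  by rewrite -(msizeN (x - y)) opprB; have := msizeD_le x (y - x); rewrite addrC subrK.
move: (msize x) (msize y) (msize (x - y)) (msize _) (msize _) sa sb sy xy h1 h2.
by clear; lia.
Qed.

Lemma wmul_eq0 (a b : W) : a * b = 0 -> a = 0 \/ b = 0.
Proof.
move=> ab; have [->|a0] := eqVneq a 0; [by left|right]; apply/eqP/negPn/negP => b0.
have := wmsizeM a0 b0; rewrite ab mmeasure0.
have sa : (0 < msize (a : V))%N by rewrite lt0n msize_poly_eq0.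
have sb : (0 < msize (b : V))%N by rewrite lt0n msize_poly_eq0.
by move: (msize _) (msize _) sa sb; clear; lia.
Qed.

Lemma wdeg1 : msize (1 : V) = 1%N.
Proof. by rewrite mmeasureC oner_eq0. Qed.

Lemma wdegY (j : 'I_(n + n)) : msize (wY K j : V) = 2%N.
Proof. by rewrite /wY msizeX mdeg1. Qed.

Lemma wmsizeM_leq (a b : W) e1 e2 : (msize (a : V) <= e1.+1)%N ->
  (msize (b : V) <= e2.+1)%N -> (msize (a * b : V) <= (e1 + e2).+1)%N.
Proof.
have [->|a0] := eqVneq a 0; first by rewrite mul0r mmeasure0.
have [->|b0] := eqVneq b 0; first by rewrite mulr0 mmeasure0.
by rewrite wmsizeM //; move: (msize _) (msize _); clear; lia.
Qed.

Lemma wmsizeX_leq (a : W) e k : (msize (a : V) <= e.+1)%N ->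
  (msize (a ^+ k : V) <= (k * e).+1)%N.
Proof.
move=> ae; elim: k => [|k IH]; first by rewrite expr0 wdeg1.
by rewrite exprS mulSn wmsizeM_leq.
Qed.

Lemma wmsize_mmap1 (z : 'I_(n + n) -> W) d m :
  (forall j, msize (z j : V) <= d.+1)%N -> (msize (mmap1 z m : V) <= (mdeg m * d).+1)%N.
Proof.
move=> zd; rewrite /mmap1 mdegE.
elim/big_rec2: _ => [|i x a _ IH]; first by rewrite wdeg1.
by rewrite mulnDl wmsizeM_leq // wmsizeX_leq.
Qed.

Lemma msize_sum_leq (I : Type) (s : seq I) (P : pred I) (F : I -> V) k :
  (forall i, P i -> (msize (F i) <= k)%N) -> (msize (\sum_(i <- s | P i) F i) <= k)%N.
Proof.
move=> Fk; elim/big_ind: _ => // [|x y xk yk]; first by rewrite mmeasure0.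
by rewrite (leq_trans (msizeD_le _ _)) // geq_max xk.
Qed.

End Bridge.

(** * Linear dependence *)

Section Steinitz.
Variables (Q : comNzRingType) (D : nzRingType) (theta : {rmorphism Q -> D}).
Hypothesis D_domain : forall x y : D, x * y = 0 -> x = 0 \/ y = 0.
Variables (I J : finType).

(** Fraction-free Gaussian elimination: a pivot not killed by [theta] clears its column by
    cross-multiplication, and its own unknown is then chosen to solve the equation [j]. Coefficients
    matter only through [theta], which may have a kernel. *)
Lemma dependent_set (C : I -> J -> Q) (A : {set I}) (B : {set J}) : (#|B| < #|A|)%N ->
  exists v : I -> Q, (exists2 i, i \in A & theta (v i) <> 0) /\
    forall j, j \in B -> theta (\sum_(i in A) v i * C i j) = 0.
Proof.
move: {2}#|B| (erefl #|B|) => b; elim: b A B C => [|b IH] A B C Bb.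
  rewrite Bb card_gt0 => /set0Pn[i iA]; exists (fun=> 1); split.
    by exists i => //; rewrite rmorph1; apply/eqP/oner_neq0.
  by move=> j; rewrite (cards0_eq Bb) inE.
move=> AB; have [j jB] : exists j, j \in B by apply/set0Pn; rewrite -card_gt0 Bb.
have B'b : #|B :\ j| = b by have := cardsD1 j B; rewrite jB Bb => -[].
have [z|] := boolP [forall i in A, theta (C i j) == 0].
  have [|v [v0 vB]] := IH A (B :\ j) C B'b; first by rewrite B'b -ltnS -Bb ltnW.
  exists v; split=> // k kB; have [->|kj] := eqVneq k j; last by apply: vB; rewrite !inE kj.
  rewrite rmorph_sum big1 // => i iA; rewrite rmorphM.
  by have /forallP/(_ i)/implyP/(_ iA)/eqP -> := z; rewrite mulr0.
rewrite negb_forall => /existsP[i0]; rewrite negb_imply => /andP[i0A c0].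
pose C' i k := C i0 j * C i k - C i j * C i0 k.
have A'b : #|A| = #|A :\ i0|.+1 by rewrite (cardsD1 i0 A) i0A.
have [|v [[i1 i1A v0] vB]] := IH (A :\ i0) (B :\ j) C' B'b.
  by rewrite B'b -ltnS -Bb -A'b.
exists (fun i => if i == i0 then - \sum_(k in A :\ i0) v k * C k j else C i0 j * v i).
have E k : \sum_(i in A) (if i == i0 then - (\sum_(l in A :\ i0) v l * C l j) else
    C i0 j * v i) * C i k = \sum_(i in A :\ i0) v i * C' i k.
  rewrite (big_setD1 i0) //= eqxx mulNr addrC mulr_suml -sumrB.
  apply: eq_bigr => i; rewrite !inE => /andP[/negPf -> _].
  by rewrite /C' mulrBr mulrCA !mulrA.
split=> [|k kB].
  move: i1A; rewrite !inE => /andP[i10 i1A]; exists i1 => //.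
  by rewrite (negPf i10) rmorphM => /D_domain[] //; apply/eqP.
rewrite E; have [->|kj] := eqVneq k j; last by apply: vB; rewrite !inE kj.
by rewrite big1 ?rmorph0 // => i _; rewrite /C' [C i j * _]mulrC subrr mulr0.
Qed.

Lemma dependent (C : I -> J -> Q) : (#|J| < #|I|)%N ->
  exists v : I -> Q, (exists i, theta (v i) <> 0) /\
    forall j, theta (\sum_i v i * C i j) = 0.
Proof.
rewrite -(cardsT I) -(cardsT J) => /(dependent_set C)[v [[i _ vi] h]].
exists v; split; first by exists i.
by move=> j; rewrite -(h j (in_setT _)); congr (theta _); apply: eq_bigl => k; rewrite inE.
Qed.

End Steinitz.

Section Domain.
Variable S : nzRingType.
Hypothesis S_domain : forall a b : S, a * b = 0 -> a = 0 \/ b = 0.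

Lemma span_dependent (Q : comNzRingType) (th : {rmorphism Q -> S}) (I J : finType)
    (a : I -> S) (g : J -> S) (C : I -> J -> Q) :
  (forall i, a i = \sum_j th (C i j) * g j) -> (#|J| < #|I|)%N ->
  exists v : I -> Q, (exists i, th (v i) <> 0) /\ \sum_i th (v i) * a i = 0.
Proof.
move=> aC IJ; have [v [v0 h]] := dependent th S_domain C IJ.
exists v; split=> //; under eq_bigr => i _ do rewrite aC mulr_sumr.
rewrite exchange_big big1 // => j _ /=.
under eq_bigr => i _ do rewrite mulrA -rmorphM.
by rewrite -mulr_suml -rmorph_sum h mul0r.
Qed.

(** Cancelling the lowest power of [a] from the relation shows that [a] divides the lowest nonzero
    coefficient. This produces nonzero multiples of [a] in a smaller ring without any inverse. *)
Lemma power_relation (k : nat) (t : 'I_k -> S) (a : S) :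
  (forall i, t i * a = a * t i) -> a <> 0 -> \sum_i t i * a ^+ i = 0 ->
  (exists i, t i <> 0) -> exists2 i0, t i0 <> 0 &
    a * - (\sum_(i < k | (i0 < i)%N) t i * a ^+ (i - i0).-1) = t i0.
Proof.
move=> ta a0 s0 [i1 /eqP ti1].
have tX i j : t i * a ^+ j = a ^+ j * t i.
  by elim: j => [|j IH]; rewrite ?expr0 ?mulr1 ?mul1r // !exprS mulrA ta -mulrA IH mulrA.
have [i0 ti0 imin] := @arg_minnP _ i1 (fun i => t i != 0) (@nat_of_ord _) ti1.
exists i0; first exact/eqP.
have aX j : a ^+ j = 0 -> a = 0.
  elim: j => [|j IH]; first by rewrite expr0 => /eqP; rewrite oner_eq0.
  by rewrite exprS => /S_domain[].
apply/eqP; rewrite -subr_eq0; apply/eqP; apply: oppr_inj; rewrite oppr0 opprB mulrN opprK.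
suff /S_domain[/aX//|//] : a ^+ i0 * (t i0 +
    a * (\sum_(i < k | (i0 < i)%N) t i * a ^+ (i - i0).-1)) = 0.
rewrite -[RHS]s0 [RHS](bigID (fun i : 'I_k => (i0 < i)%N)) /= [RHS]addrC.
rewrite [X in _ = X + _](bigD1 i0) ?ltnn //= [X in _ = _ + X + _]big1 ?addr0; last first.
  move=> i /andP[]; rewrite -leqNgt => ii0 ne.
  suff -> : t i = 0 by rewrite mul0r.
  apply/eqP/negPn/negP => /imin /= i0i; move/eqP: ne; apply.
  by apply/val_inj/eqP; rewrite eqn_leq ii0.
rewrite mulrDr -tX; congr (_ + _); rewrite mulrA -exprSr mulr_sumr.
apply: eq_bigr => i i0i; rewrite mulrA -tX -mulrA -exprD; congr (_ * _ ^+ _).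
by move: i0i; clear; case: i0 i => /= i0 _ [i _] /=; lia.
Qed.

End Domain.

Section Counting.
Variables (K : fieldType).

Lemma mpoly_dependent (N b : nat) (I : finType) (a : I -> {mpoly K[N]}) :
  (forall i, (msize (a i) <= b)%N) -> (#|{: bmultinom N b}| < #|I|)%N ->
  exists c : I -> K, (exists i, c i != 0) /\ \sum_i c i *: a i = 0.
Proof.
move=> ab IJ.
have dom (x y : K) : x * y = 0 -> x = 0 \/ y = 0.
  by move/eqP; rewrite mulf_eq0 => /orP[/eqP|/eqP]; [left|right].
have [c [[i ci] h]] := @dependent K K idfun dom _ _ (fun i (m : bmultinom N b) => (a i)@_m) IJ.
exists c; split; first by exists i; apply/eqP.
apply/mpolyP => m; rewrite raddf_sum mcoeff0 /=.
have [mb|mb] := ltnP (mdeg m) b.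
  by rewrite -[RHS](h (BMultinom mb)) /=; apply: eq_bigr => k _; rewrite mcoeffZ.
rewrite big1 // => k _; rewrite mcoeffZ memN_msupp_eq0 ?mulr0 //.
by apply: msize_mdeg_ge; rewrite (leq_trans (ab k)).
Qed.

(* Euclidean division of the exponents by [d.+1]. *)
Lemma card_bmultinom_mul (N d M : nat) :
  (#|{: bmultinom N (d.+1 * M).+1}| <= d.+1 ^ N * #|{: bmultinom N M.+1}|)%N.
Proof.
pose q (m : 'X_{1..N}) := [multinom m i %/ d.+1 | i < N].
have qM (m : bmultinom N (d.+1 * M).+1) : (mdeg (q m) < M.+1)%N.
  rewrite ltnS -(leq_pmul2l (ltn0Sn d)); apply: leq_trans (_ : mdeg m <= _)%N.
    rewrite !mdegE big_distrr leq_sum // => i _.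
    by rewrite mnmE /= [(_ * (_ %/ _))%N]mulnC leq_trunc_div.
  by rewrite -ltnS bmdeg.
pose f (m : bmultinom N (d.+1 * M).+1) :=
  ([ffun i : 'I_N => inord (m i %% d.+1) : 'I_d.+1], BMultinom (qM m)).
have f_inj : injective f.
  move=> m m' fmm; have /ffunP e1 := congr1 fst fmm.
  have e2 : q m = q m' := congr1 (fun t => bmnm t.2) fmm; apply/val_inj/mnmP => i /=.
  have := congr1 (fun q : 'X_{1..N} => q i) e2; have := congr1 val (e1 i); rewrite !ffunE !mnmE /=.
  rewrite !inordK ?ltn_pmod // => er eq.
  by rewrite (divn_eq (m i) d.+1) (divn_eq (m' i) d.+1) er eq.
by have := leq_card f f_inj; rewrite card_prod card_ffun !card_ord.
Qed.

Variable n : nat.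
Local Notation W := (weylR n K).
Local Notation V := {mpoly K[n + n]}.

Definition wrank (d : nat) := (d.+1 ^ (n + n))%N.

(** The products of the [a i] with the monomials of degree at most [M] in the [z j] all lie in
    degree at most [(d+1)M]; with more than [wrank d] indices they outnumber the monomials there. A
    scalar relation, grouped by [i], gives the [P i]. *)
Lemma wendo_dependent (d M : nat) (z : 'I_(n + n) -> W) (I : finType) (a : I -> W) :
  (wrank d < #|I|)%N ->
  (forall j, msize (z j : V) <= d.+1)%N -> (forall i, msize (a i : V) <= M.+1)%N ->
  exists P : I -> W,
    [/\ forall i, (msize (P i : V) <= M.+1)%N, exists i, P i != 0 &
        \sum_i a i * wendo z (P i) = 0].
Proof.
move=> Id zd aM; pose J := (I * bmultinom (n + n) M.+1)%type.
pose u (t : J) : V := (a t.1 * mmap1 z t.2 : W).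
have uM t : (msize (u t) <= (d.+1 * M).+1)%N.
  rewrite mulSn; apply: wmsizeM_leq; first exact: aM.
  apply: leq_trans (wmsize_mmap1 _ zd) _; rewrite ltnS mulnC leq_mul2l.
  by rewrite -ltnS bmdeg orbT.
have cI : (#|{: bmultinom (n + n) (d.+1 * M).+1}| < #|{: J}|)%N.
  rewrite card_prod; apply: leq_ltn_trans (card_bmultinom_mul _ _ _) _.
  rewrite ltn_pmul2r //; apply/card_gt0P; by exists (bm0 : bmultinom _ _).
have [c [[[i m] ci] h]] := mpoly_dependent uM cI.
exists (fun i => \sum_(m : bmultinom (n + n) M.+1) c (i, m) *: 'X_[m] : V); split.
- move=> k; apply: msize_sum_leq => l _; apply: leq_trans (mmeasureZ_le _ _ _) _.
  by rewrite msizeX bmdeg.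
- exists i; apply: contraNneq ci => /(congr1 (mcoeff m)).
  rewrite mcoeff0 raddf_sum (bigD1 m) //= mcoeffZ mcoeffX eqxx mulr1 big1 ?addr0 => [->//|l].
  by move=> lm; rewrite mcoeffZ mcoeffX -bmeqP (negPf lm) mulr0.
rewrite -[RHS]h; rewrite (eq_bigr (fun t => c (t.1, t.2) *: u (t.1, t.2))); last by case.
rewrite -(pair_bigA _ (fun k l => c (k, l) *: u (k, l))) /=; apply: eq_bigr => k _.
rewrite /wendo raddf_sum mulr_sumr; apply: eq_bigr => l _ /=.
by rewrite wevZ wevX mulr_algl -scalerAr.
Qed.

(* If [g j] had a larger degree, the terms of the relation [sum_i (g j)^i P_i = 0] would
   have pairwise distinct degrees. *)
Lemma inverse_degree (d : nat) (z g : 'I_(n + n) -> W) : wrel g ->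
  (forall j, msize (z j : V) <= d.+1)%N -> (forall j, wendo g (z j) = wY K j) ->
  forall j, (msize (g j : V) <= (wrank d).+1)%N.
Proof.
move=> gr zd gz j; set r := wrank d; rewrite leqNgt; apply/negP => rg.
(* Exponents run up to r, so r itself serves as the degree bound [M], and the [P i] have degree at
   most r. *)
have Yr (i : 'I_r.+1) : (msize (wY K j ^+ i : V) <= r.+1)%N.
  have := @wmsizeX_leq n K (wY K j) 1 i; rewrite wdegY muln1 => /(_ isT) h.
  by apply: leq_trans h _; apply: ltn_ord.
have rI : (r < #|{: 'I_r.+1}|)%N by rewrite card_ord.
have [P [Pr [i0 Pi0] sP]] := wendo_dependent rI zd Yr.
(* Applying the inverse [g] turns [wendo z (P i)] back into [P i] and the generator into [g j]. *)
have {sP}sP : \sum_(i < r.+1) g j ^+ i * P i = 0.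
  have := congr1 (wendo g) sP; rewrite wendo0 wendo_sum => e; rewrite -[RHS]e.
  by apply: eq_bigr => i _; rewrite wendoM // wendoK // wendoXn // wendoY.
(* The term of highest index dominates: since [P k] has smaller degree than [g j], every lower term
   has degree below that of [g j ^+ i] alone. *)
have [i Pi imax] := @arg_maxnP _ i0 (fun i => P i != 0) (@nat_of_ord _) Pi0.
have sz (k : nat) : (msize (g j ^+ k : V) = (k * (msize (g j : V)).-1).+1)%N.
  have g0 : g j != 0 by rewrite -(msize_poly_eq0 (g j : V)) -lt0n (leq_trans _ rg).
  elim: k => [|k IH]; first by rewrite expr0 wdeg1.
  rewrite exprS wmsizeM ?IH //; last by rewrite -(msize_poly_eq0 (g j ^+ k : V)) IH.
  by move: (msize _) rg => s; clear; nia.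
have gX k : g j ^+ k != 0 by rewrite -(msize_poly_eq0 (g j ^+ k : V)) sz.
have := @msize_sum_leq n K 'I_r.+1 (index_enum _) (fun k => k != i)
  (fun k => - (g j ^+ k * P k)) (i * (msize (g j : V)).-1)%N.
have -> : \sum_(k | k != i) - (g j ^+ k * P k) = g j ^+ i * P i.
  by apply/eqP; rewrite sumrN eq_sym -addr_eq0; move: sP; rewrite (bigD1 i) //= => ->.
have Pi1 : (0 < msize (P i : V))%N by rewrite lt0n msize_poly_eq0.
rewrite wmsizeM // sz => h.
suff /h : forall k, k != i -> (msize (- (g j ^+ k * P k) : V) <= i * (msize (g j : V)).-1)%N.
  by move: (msize (P i : V)) Pi1; clear; lia.
move=> k ki; rewrite msizeN; have [->|Pk] := eqVneq (P k) 0; first by rewrite mulr0 mmeasure0.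
have ik : (k < i)%N by rewrite ltn_neqAle ki; apply: imax.
rewrite wmsizeM // sz; move: (Pr k) rg ik.
by move: (msize _) (msize _) (nat_of_ord k) (nat_of_ord i); clear; nia.
Qed.

End Counting.

(** * The centre in positive characteristic *)

Section Centre.
Variables (n p : nat) (L : fieldType).
Local Notation W := (weylR n L).
Local Notation V := {mpoly L[n + n]}.
Local Notation P := {mpoly L[n + n]}.
Local Notation Y := (@wY n L).
Hypothesis charp : p \in [pchar L].

Lemma wYn j k : Y j ^+ k = ('X_[U_(j) *+ k] : V).
Proof.
elim: k => [|k IH]; first by rewrite expr0 mulm0n mpolyX0.
rewrite exprS IH wY_mul mulmS mpolyXD; case: (split_ordP j) => i ->.
  by rewrite wL_lshift.
rewrite wL_rshift mderivX mulmnE mnm1E eq_rlshift mul0n scale0r subr0.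
reflexivity.
Qed.

Definition central (a : W) := forall b, a * b = b * a.

Lemma central_of_gens (a : W) : (forall j, a * Y j = Y j * a) -> central a.
Proof.
move=> aY; elim/wY_ind => [||c x y IHx IHy|j x IH].
- by rewrite mul0r mulr0.
- by rewrite mul1r mulr1.
- by rewrite mulrDr mulrDl -scalerAr -scalerAl IHx IHy.
- by rewrite mulrA aY -!mulrA IH.
Qed.

Lemma centralYp j : central (Y j ^+ p).
Proof.
have dp i : mderiv i ('X_[U_(j) *+ p] : V) = 0.
  by rewrite mderivX mulmnE natrM -(scalerA) (pcharf0 charp) scale0r scaler0.
apply: central_of_gens => k; rewrite wYn; apply/esym/eqP; rewrite -subr_eq0.
case: (split_ordP k) => i ->; first by rewrite wcommY_lshift dp.
by rewrite wcommY_rshift dp oppr0.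
Qed.

(* The unused argument lets the morphism structure be inferred from the term. *)
Definition wiota of p \in [pchar L] : P -> W :=
  mmap (in_alg W) (fun j => Y j ^+ p).

Lemma wiota_is_additive : zmod_morphism (wiota charp).
Proof. exact: raddfB. Qed.
HB.instance Definition _ := GRing.isZmodMorphism.Build P W (wiota charp) wiota_is_additive.

Lemma wiota_is_multiplicative : monoid_morphism (wiota charp).
Proof.
have [] := @commr_mmap_is_multiplicative _ _ _ (fun j => Y j ^+ p) (in_alg W).
- by move=> i x; apply/esym/centralYp.
- by move=> q m m'; apply: wcentral_alg.
by [].
Qed.
HB.instance Definition _ := GRing.isMonoidMorphism.Build P W (wiota charp) wiota_is_multiplicative.

Lemma wiota0 : wiota charp 0 = 0. Proof. exact: raddf0. Qed.
Lemma wiotaD f g : wiota charp (f + g) = wiota charp f + wiota charp g.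
Proof. exact: raddfD. Qed.
Lemma wiotaXn f k : wiota charp (f ^+ k) = wiota charp f ^+ k.
Proof. exact: rmorphXn. Qed.
Lemma wiota_prod (I : Type) (s : seq I) (A : pred I) (f : I -> P) :
  wiota charp (\prod_(i <- s | A i) f i) = \prod_(i <- s | A i) wiota charp (f i).
Proof. exact: rmorph_prod. Qed.

Lemma wiotaZ c q : wiota charp (c *: q) = c *: wiota charp q.
Proof. by rewrite /wiota mmapZ mulr_algl. Qed.

Definition pmul (m : 'X_{1..n + n}) : 'X_{1..n + n} := [multinom (p * m k)%N | k < n + n].

Lemma mmap1_Yp m : mmap1 (fun j => Y j ^+ p) m = ('X_[pmul m] : V).
Proof.
rewrite -mmap1_wY /mmap1; apply: eq_bigr => i _.
by rewrite -exprM mnmE.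
Qed.

Lemma wiotaX m : wiota charp 'X_[m] = ('X_[pmul m] : V).
Proof. by rewrite /wiota mmapX mmap1_Yp. Qed.

Lemma center_iotaE f : center_iota p f = wiota charp f.
Proof.
rewrite /center_iota /wiota /mmap; apply: eq_bigr => m _.
by rewrite mulr_algl mmap1_Yp.
Qed.

Lemma p_gt0 : (0 < p)%N. Proof. exact/prime_gt0/(pcharf_prime charp). Qed.

Lemma pmul_inj : injective pmul.
Proof.
move=> m m' /mnmP e; apply/mnmP => i; have := e i; rewrite !mnmE => /eqP.
by rewrite eqn_pmul2l ?p_gt0 // => /eqP.
Qed.

Lemma mcoeff_iota f m : (wiota charp f : V)@_(pmul m) = f@_m.
Proof.
elim/mpolyind: f => [|c m' q _ _ IH]; first by rewrite raddf0 !mcoeff0.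
rewrite raddfD /= !mcoeffD IH; congr (_ + _).
by rewrite wiotaZ wiotaX !mcoeffZ !mcoeffX (inj_eq pmul_inj).
Qed.

Lemma wiota_inj : injective (wiota charp).
Proof. by move=> f g fg; apply/mpolyP => m; rewrite -(mcoeff_iota f m) -(mcoeff_iota g m) fg. Qed.

Lemma wiota_eq0 f : wiota charp f = 0 -> f = 0.
Proof. by move=> f0; apply: wiota_inj; rewrite f0 raddf0. Qed.

Lemma wiota_central f : central (wiota charp f).
Proof.
elim/mpolyind: f => [|c m q _ _ IH] b; first by rewrite raddf0 mul0r mulr0.
rewrite wiotaD mulrDl mulrDr IH wiotaZ -scalerAl -scalerAr; congr (_ *: _ + _).
rewrite /wiota mmapX /mmap1; elim/big_ind: _ b => [b|x y Hx Hy b|i _ b].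
- by rewrite mul1r mulr1.
- by rewrite -mulrA Hy mulrA Hx mulrA.
- elim: (m i) b => [|k IHk] b; first by rewrite expr0 mul1r mulr1.
  by rewrite exprS -mulrA IHk mulrA centralYp mulrA.
Qed.

(** Commuting with the generators kills all partial derivatives, so only exponents divisible by [p]
    occur. *)
Lemma central_iota (a : W) : (forall j, a * Y j = Y j * a) -> exists f, a = wiota charp f.
Proof.
move=> aY.
have da j : mderiv j (a : V) = 0.
  case: (split_ordP j) => i ->; first apply: oppr_inj.
    by rewrite -wcommY_rshift aY subrr oppr0.
  by rewrite -wcommY_lshift aY subrr.
have dvd m : m \in msupp (a : V) -> forall j, (p %| m j)%N.
  rewrite mcoeff_msupp => am j; have [->|mj] := eqVneq (m j) 0%N; first exact: dvdn0.
  have := congr1 (mcoeff (m - U_(j))) (da j).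
  rewrite mcoeff_deriv mcoeff0 submK ?lep1mP // mnmBE mnm1E eqxx subn1 prednK ?lt0n //.
  rewrite -mulr_natr => /eqP; rewrite mulf_eq0 (negPf am) /= => mj0.
  by rewrite (dvdn_pcharf charp).
pose f := \sum_(m <- msupp (a : V)) (a : V)@_m *: 'X_[L, [multinom (m i %/ p)%N | i < n + n]].
exists f; rewrite {1}[a]mpolyE /f raddf_sum /= big_seq [RHS]big_seq.
apply: eq_bigr => m /dvd pm; rewrite wiotaZ wiotaX; congr (_ *: 'X_[_]).
by apply/mnmP => i; rewrite !mnmE mulnC divnK.
Qed.

End Centre.

(** * Bases over the centre *)

Section PBasis.
Variables (n p : nat) (L : fieldType).
Local Notation W := (weylR n L).
Local Notation V := {mpoly L[n + n]}.
Local Notation P := {mpoly L[n + n]}.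

Local Notation Y := (@wY n L).
Hypothesis charp : p \in [pchar L].
Local Notation T := {ffun 'I_(n + n) -> 'I_p}.
Local Notation io := (wiota charp).

Definition tmnm (t : T) : 'X_{1..n + n} := [multinom t i : nat | i < n + n].

Lemma tmnm_inj : injective tmnm.
Proof.
move=> t t' /mnmP e; apply/ffunP => i; apply: val_inj.
by have := e i; rewrite !mnmE.
Qed.

Lemma weyl_natmul_inj (x : W) k : (0 < k < p)%N -> x *+ k = 0 -> x = 0.
Proof.
case/andP=> k0 kp; rewrite -scaler_nat => /eqP; rewrite scaler_eq0 -(dvdn_pcharf charp).
by rewrite gtnNdvd //= => /eqP.
Qed.

(** Euclidean division of the exponents by [p]; the quotient part is central and can be collected in
    front. *)
Lemma wiota_span (a : W) : exists F : T -> P, a = \sum_t io (F t) * mmap1 Y (tmnm t).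
Proof.
have p0 := p_gt0 charp.
elim/mpolyind: a => [|c m a _ _ [F ->]].
  by exists (fun=> 0); rewrite big1 // => t _; rewrite raddf0 mul0r.
pose t0 : T := [ffun i => Ordinal (ltn_pmod (m i) p0)].
pose q : 'X_{1..n + n} := [multinom (m i %/ p)%N | i < n + n].
exists (fun t => (if t == t0 then c *: 'X_[q] else 0) + F t).
under [RHS]eq_bigr do rewrite raddfD mulrDl.
rewrite big_split /=; congr (_ + _).
rewrite (bigD1 t0) //= eqxx big1 ?addr0 => [|t /negPf ->]; last by rewrite raddf0 mul0r.
rewrite wiotaZ -scalerAl; congr (_ *: _).
rewrite /wiota mmapX -mmap1_wY /mmap1.
have yi i k b : (Y i ^+ p) ^+ k * b = b * (Y i ^+ p) ^+ k.
  elim: k b => [|k IH] b; first by rewrite expr0 mulr1 mul1r.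
  by rewrite exprS -mulrA IH mulrA centralYp // -mulrA.
suff [] : \prod_(i < n + n) Y i ^+ m i =
    (\prod_(i < n + n) (Y i ^+ p) ^+ q i) * \prod_(i < n + n) Y i ^+ tmnm t0 i /\
    central (\prod_(i < n + n) (Y i ^+ p) ^+ q i) by [].
elim/big_rec3: _ => [|i x y u _ [-> yc]].
  by rewrite mul1r; split=> // b; rewrite mul1r mulr1.
split; last by move=> b; rewrite -mulrA yc mulrA yi mulrA.
rewrite !mnmE ffunE /= {1}(divn_eq (m i) p) exprD mulnC exprM -!mulrA; congr (_ * _).
by rewrite mulrA -yc -!mulrA.
Qed.

Variable z : 'I_(n + n) -> W.
Hypothesis zrel : wrel z.

(** Exponents below [p] keep invertible the integers met in [wev_independent]. The coefficients only
    have to commute with the [z j], which admits polynomials over the centre in an element of the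
    commutant. *)
Lemma sum_tmnm_independent (Q : comNzRingType) (theta : {rmorphism Q -> W}) (F : T -> Q) :
  (forall c j, theta c * z j = z j * theta c) ->
  \sum_t theta (F t) * mmap1 z (tmnm t) = 0 -> forall t, theta (F t) = 0.
Proof.
move=> thz s0 t.
pose f : {mpoly Q[n + n]} := \sum_t F t *: 'X_[tmnm t].
have fE t' : f@_(tmnm t') = F t'.
  rewrite /f raddf_sum (bigD1 t') //= mcoeffZ mcoeffX eqxx mulr1 big1 ?addr0 // => s st.
  by rewrite mcoeffZ mcoeffX (inj_eq tmnm_inj) (negPf st) mulr0.
rewrite -fE; apply: (wev_independent zrel thz).
  move=> m mf i k /andP[k0 km] x; apply: weyl_natmul_inj; rewrite k0 (leq_ltn_trans km) //.
  suff [s ->] : exists s, m = tmnm s by rewrite mnmE.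
  move: mf; rewrite mcoeff_msupp /f raddf_sum /= => nz.
  have /existsP[s /eqP ms] : [exists s, m == tmnm s].
    apply: contraNT nz; rewrite negb_exists => /forallP h.
    by rewrite big1 // => s _; rewrite mcoeffZ mcoeffX eq_sym (negPf (h s)) mulr0.
  by exists s.
rewrite -[RHS]s0 /f raddf_sum /=; apply: eq_bigr => s _.
by rewrite wevZ wevX.
Qed.

Lemma weyl_mulI (a b : W) : a * b = 0 -> a <> 0 -> b = 0.
Proof. by move=> /wmul_eq0[]. Qed.

(* Otherwise the [z^t] and [c z^t] would be twice too many independent elements over
   the centre. *)
Lemma commutant_central (c : W) : (forall j, c * z j = z j * c) -> central c.
Proof.
move=> cz.
pose a (i : (T + T)%type) : W :=
  match i with inl t => mmap1 z (tmnm t) | inr t => c * mmap1 z (tmnm t) end.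
have [C hC] := fin_all_exists (fun i => wiota_span (a i)).
have [|v [v0 hv]] := span_dependent (@wmul_eq0 n L) hC.
  by rewrite card_sum -addn1 leq_add2l; apply/card_gt0P; exists [ffun=> Ordinal (p_gt0 charp)].
have cio : commr_rmorph (wiota charp) c by move=> q; apply/esym/wiota_central.
(* The combined coefficients of the [z^t] are values at [c] of linear polynomials over the centre,
   so independence applies to them. *)
pose F t := (v (inl t))%:P + (v (inr t))%:P * 'X : {poly P}.
have FE t : horner_morph cio (F t) = io (v (inl t)) + io (v (inr t)) * c.
  by rewrite /F rmorphD rmorphM /= !horner_morphC horner_morphX.
have thz q j : horner_morph cio q * z j = z j * horner_morph cio q.
  elim/poly_ind: q => [|q r IH]; first by rewrite raddf0 mul0r mulr0.
  rewrite rmorphD rmorphM /= horner_morphC horner_morphX mulrDl mulrDr wiota_central.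
  by rewrite -mulrA cz mulrA IH -mulrA.
have F0 : \sum_t horner_morph cio (F t) * mmap1 z (tmnm t) = 0.
  rewrite -[RHS]hv big_sumType /= -big_split /=; apply: eq_bigr => t _.
  by rewrite FE mulrDl mulrA.
have {F0}F0 t : io (v (inl t)) + io (v (inr t)) * c = 0.
  by rewrite -FE; apply: sum_tmnm_independent F0 t.
have [t vt] : exists t, io (v (inr t)) <> 0.
  have [[t|t] vi] := v0; exists t => // vr.
  by apply: vi; have := F0 t; rewrite vr mul0r addr0.
have e : io (v (inr t)) * c = - io (v (inl t)).
  by apply/eqP; rewrite -addr_eq0 addrC F0.
(* A nonzero central multiple of [c] is central; the multiplier is cancelled from the commutator of
   [c] with [b]. *)
move=> b; apply/eqP; rewrite -subr_eq0; apply/eqP; apply: weyl_mulI vt.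
rewrite mulrBr !mulrA e [io (v (inr t)) * b]wiota_central -(mulrA b) e.
by rewrite mulNr mulrN wiota_central subrr.
Qed.

(** Since the [p]-th powers of the generators are central, the [z j ^+ p] commute with the whole
    image, hence with everything by [commutant_central]. *)
Lemma image_centre : exists F : (n + n).-tuple P, forall j, z j ^+ p = io (tnth F j).
Proof.
have h j : exists f : P, z j ^+ p = io f.
  apply: central_iota => // k; apply: commutant_central => i.
  have e : z j ^+ p = wendo z (Y j ^+ p) by rewrite (wendoXn _ _ zrel) wendoY.
  by rewrite e -[z i]wendoY -[LHS](wendoM zrel) -[RHS](wendoM zrel) centralYp.
have [F hF] := fin_all_exists h.
by exists [tuple F i | i < n + n] => j; rewrite tnth_mktuple.
Qed.

Lemma wendo_iota (F : (n + n).-tuple P) : (forall j, z j ^+ p = io (tnth F j)) ->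
  forall g, wendo z (io g) = io (g \mPo F).
Proof.
move=> zF; elim/mpolyind => [|c m g _ _ IH].
  by rewrite comp_mpoly0 wiota0 wendo0.
have e : wendo z (io 'X_[m]) = io ('X_[m] \mPo F).
  rewrite comp_mpolyX wiota_prod /wiota mmapX /mmap1.
  elim/big_rec2: _ => [|i x y _ <-]; first exact: wendo1.
  by rewrite (wendoM zrel) !(wendoXn _ _ zrel) wendoY zF -/(wiota charp _) wiotaXn.
by rewrite comp_mpolyD comp_mpolyZ !wiotaD !wiotaZ wendoD wendoZ IH e.
Qed.

(** Injectivity in degree less than [p], where all exponents are below [p]. *)
Lemma wendo_low_eq0 (a : W) : (msize (a : V) <= p)%N -> wendo z a = 0 -> a = 0.
Proof.
move=> ap a0; apply/mpolyP => m; rewrite mcoeff0.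
have h : in_alg W (a : V)@_m = 0.
  move: m; apply: (@wev_independent n L W (in_alg W) z zrel _ a _ a0).
    by move=> c j; apply: wcentral_alg.
  move=> m am i k /andP[k0 km] x; apply: weyl_natmul_inj.
  rewrite k0 (leq_ltn_trans km) //; apply: leq_trans ap.
  by apply: leq_ltn_trans (msize_mdeg_lt am); rewrite mdegE (bigD1 i) //= leq_addr.
by apply/eqP; move/eqP: h; rewrite scaler_eq0 oner_eq0 orbF.
Qed.

End PBasis.

(** * Rank over the image of an endomorphism *)

(* [S] is the Weyl algebra in characteristic [p], [io] embeds its centre, [kappa] is
   the restriction of the endomorphism [phi] to the centre, [y] is the basis of [S]
   over the centre formed by the monomials with exponents below [p], [Y] are the
   generators and [fil e] is the space of elements of degree at most [e]. *)
Section AbstractRank.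
Variables (P : idomainType) (S : nzRingType).
Variables (io : {rmorphism P -> S}) (kappa : {rmorphism P -> P}) (phi : {rmorphism S -> S}).
Variables (T G : finType) (y : T -> S) (Y : G -> S) (fil : nat -> S -> Prop) (r p : nat).
Hypothesis S_domain : forall a b : S, a * b = 0 -> a = 0 \/ b = 0.
Hypothesis io_central : forall g b, io g * b = b * io g.
Hypothesis io_inj : forall g, io g = 0 -> g = 0.
Hypothesis phi_io : forall g, phi (io g) = io (kappa g).
Hypothesis y_span : forall a, exists H : T -> P, a = \sum_t io (H t) * y t.
Hypothesis y_indep : forall H : T -> P,
  \sum_t io (H t) * phi (y t) = 0 -> forall t, io (H t) = 0.
Hypothesis S_ind : forall Q : S -> Prop, Q 0 -> Q 1 ->
  (forall a b, Q a -> Q b -> Q (a + b)) -> (forall a b, Q a -> Q (a * phi b)) ->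
  (forall j a, Q a -> Q (Y j * a)) -> forall a, Q a.
Hypothesis fil1 : fil 0 1.
Hypothesis fil_leq : forall e e' a, (e <= e')%N -> fil e a -> fil e' a.
Hypothesis filY : forall e j a, fil e a -> fil e.+1 (Y j * a).
Hypothesis fil_dep : forall (I : finType) (b : I -> S) e, (e < p)%N -> (r < #|I|)%N ->
  (forall i, fil e (b i)) ->
  exists Q : I -> S, (exists i, phi (Q i) <> 0) /\ \sum_i b i * phi (Q i) = 0.
Hypothesis rp : (r < p)%N.

Definition theta (g : P) : S := io (kappa g).
HB.instance Definition _ := GRing.RMorphism.copy theta (io \o kappa).

Lemma theta_central g a : theta g * a = a * theta g.
Proof. exact: io_central. Qed.

Lemma image_span (a : S) : exists H : T -> P, phi a = \sum_t theta (H t) * phi (y t).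
Proof.
have [H ->] := y_span a; exists H; rewrite rmorph_sum; apply: eq_bigr => t _.
by rewrite rmorphM phi_io.
Qed.

(** The image of [phi] is spanned by the [phi (y t)] over the image of the centre, so the powers of
    [phi a] satisfy a relation, and [power_relation] applies. This plays the part of the Ore
    condition. *)
Lemma central_multiple (a : S) : phi a <> 0 ->
  exists a' h, phi a * phi a' = theta h /\ theta h <> 0.
Proof.
move=> a0; pose k := #|{: T}|.
have [C hC] := fin_all_exists (fun i : 'I_k.+1 => image_span (a ^+ i)).
have [|v [v0 hv]] := span_dependent S_domain hC; first by rewrite card_ord.
have [|i0 vi0 e] := power_relation S_domain (fun i => theta_central (v i) (phi a)) a0 _ v0.
  by rewrite -[RHS]hv; apply: eq_bigr => i _; rewrite rmorphXn.
exists (- \sum_(i < k.+1 | (i0 < i)%N) io (v i) * a ^+ (i - i0).-1), (v i0); split=> //.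
rewrite -e rmorphN rmorph_sum; congr (_ * - _); apply: eq_bigr => i _.
by rewrite rmorphM rmorphXn phi_io.
Qed.

(** Membership in the right span of [b] over the image of [phi], up to a denominator. By
    [central_multiple] the denominator may be taken in the image of the centre. *)
Definition phi_incl (I : finType) (b : I -> S) (a : S) : Prop :=
  exists h (beta : I -> S), theta h <> 0 /\ a * theta h = \sum_i b i * phi (beta i).

Definition phi_indep (I : finType) (b : I -> S) : Prop :=
  forall beta : I -> S, \sum_i b i * phi (beta i) = 0 -> forall i, phi (beta i) = 0.

Lemma phi_indep_card (I : finType) (b : I -> S) e : phi_indep b ->
  (forall i, fil e (b i)) -> (e < p)%N -> (#|I| <= r)%N.
Proof.
move=> bI be ep; rewrite leqNgt; apply/negP => rI.
by have [Q [[i Qi] /bI h]] := fil_dep ep rI be; apply: Qi.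
Qed.

(** If the coefficient of [a] in a relation were nonzero, a central multiple of it would be a
    denominator expressing [a] through [b]. *)
Lemma phi_indep_extend (I : finType) (b : I -> S) (a : S) : phi_indep b ->
  ~ phi_incl b a ->
  phi_indep (fun i : (I + 'I_1)%type => match i with inl i => b i | inr _ => a end).
Proof.
move=> bI ba beta; rewrite big_sumType big_ord1 /= => s0.
have a0 : phi (beta (inr ord0)) = 0.
  apply: contrapT => /central_multiple[q [h [qh h0]]]; apply: ba.
  exists h, (fun i => - (beta (inl i) * q)); split=> //.
  rewrite -qh mulrA -[RHS]opprK -sumrN.
  have -> : \sum_i - (b i * phi (- (beta (inl i) * q))) =
            (\sum_i b i * phi (beta (inl i))) * phi q.
    rewrite mulr_suml; apply: eq_bigr => i _.
    by rewrite rmorphN rmorphM mulrN opprK mulrA.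
  by rewrite -mulNr; congr (_ * _); apply/eqP; rewrite -addr_eq0 addrC s0.
move: s0; rewrite a0 mulr0 addr0 => /bI h [i|i]; first exact: h.
by rewrite ord1.
Qed.

(* If every degree [k <= r] contributed a new independent element, there would be
   [r.+1] of them in degree less than [p]. *)
Lemma staircase : exists (I : finType) (b : I -> S) (e : nat),
  [/\ phi_indep b, (#|I| <= r)%N &
      forall a, fil e.+1 a -> phi_incl b a] /\
  forall i, fil e (b i).
Proof.
apply: contrapT => no.
suff h k : (k <= r)%N -> exists (I : finType) (b : I -> S),
    [/\ phi_indep b, #|I| = k.+1 & forall i, fil k (b i)].
  have [I [b [bI cI bk]]] := h _ (leqnn _).
  by have := phi_indep_card bI bk rp; rewrite cI ltnn.
elim: k => [|k IH] kR.
  exists 'I_1, (fun=> 1); split=> [beta||_]; last exact: fil1.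
    by rewrite big_ord1 mul1r => b0 i; rewrite ord1.
  by rewrite card_ord.
have [I [b [bI cI bk]]] := IH (ltnW kR).
have [a [ak ba]] : exists a : S, fil k.+1 a /\ ~ phi_incl b a.
  apply: contrapT => nex; apply: no; exists I, b, k; split=> //; split=> //.
    by rewrite cI.
  by move=> a ak; apply: contrapT => ba; apply: nex; exists a.
exists (I + 'I_1)%type, (fun i => match i with inl i => b i | inr _ => a end).
split; first exact: phi_indep_extend.
  by rewrite card_sum cI card_ord addn1.
by case=> [i|_] //; apply: fil_leq (leqnSn k) (bk i).
Qed.

Section Closure.
Variables (I : finType) (b : I -> S).

Lemma theta_mul_neq0 g h : theta g <> 0 -> theta h <> 0 -> theta (g * h) <> 0.
Proof. by rewrite rmorphM => g0 h0 /S_domain[]. Qed.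

Lemma phi_incl0 : phi_incl b 0.
Proof.
exists 1, (fun=> 0); split; first by rewrite rmorph1; apply/eqP/oner_neq0.
by rewrite mul0r big1 // => i _; rewrite rmorph0 mulr0.
Qed.

Lemma phi_inclD x x' : phi_incl b x -> phi_incl b x' -> phi_incl b (x + x').
Proof.
move=> [g [be [g0 xg]]] [h [ga [h0 yh]]].
exists (g * h), (fun i => be i * io h + ga i * io g); split; first exact: theta_mul_neq0.
rewrite rmorphM mulrDl {2}[theta g * _]theta_central !mulrA xg yh !mulr_suml -big_split.
apply: eq_bigr => i _ /=.
by rewrite rmorphD !rmorphM !phi_io mulrDr !mulrA.
Qed.

Lemma phi_inclMr x a : phi_incl b x -> phi_incl b (x * phi a).
Proof.
move=> [g [be [g0 xg]]]; exists g, (fun i => be i * a); split=> //.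
rewrite -mulrA -theta_central mulrA xg mulr_suml; apply: eq_bigr => i _.
by rewrite rmorphM mulrA.
Qed.

Lemma phi_incl_sum (J : finType) (x : J -> S) :
  (forall j, phi_incl b (x j)) -> phi_incl b (\sum_j x j).
Proof. by move=> xb; elim/big_ind: _ => // [|u v]; [apply: phi_incl0 | apply: phi_inclD]. Qed.

Lemma phi_incl_cancel x g : theta g <> 0 -> phi_incl b (x * theta g) -> phi_incl b x.
Proof.
move=> g0 [h [be [h0 e]]]; exists (g * h), be; split; first exact: theta_mul_neq0.
by rewrite rmorphM mulrA.
Qed.

(* Stability in one degree propagates by left multiplication by the generators. *)
Lemma phi_incl_all e : (forall i, fil e (b i)) ->
  (forall a, fil e.+1 a -> phi_incl b a) -> forall a, phi_incl b a.
Proof.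
move=> be low; apply: S_ind => [||x x' bx bx'|x c bx|j x [h [ga [h0 xh]]]].
- exact: phi_incl0.
- by apply: low; apply: fil_leq fil1.
- exact: phi_inclD.
- exact: phi_inclMr.
(* Once the denominator is cleared only the elements [Y j * b i] are left, of degree at most
   [e.+1]. *)
apply: (phi_incl_cancel h0); rewrite -mulrA xh mulr_sumr; apply: phi_incl_sum => i.
by rewrite mulrA; apply: phi_inclMr; apply: low; apply: filY.
Qed.

End Closure.

(** A comparison of ranks over the image of the centre: multiplied by the [phi (y t)], the [c j]
    give [#|J| * #|T|] elements, up to denominators, in the span of the [#|I| * #|T|] elements
    [b i * phi (y s)]. *)
Lemma central_rank_bound (J : finType) (c : J -> P) :
  (forall v : J -> P, \sum_j kappa (v j) * c j = 0 -> forall j, kappa (v j) = 0) ->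
  (0 < #|T|)%N -> (#|J| <= r)%N.
Proof.
move=> cI T0; have [I [b [e [[bI Ir low] be]]]] := staircase.
apply: leq_trans Ir; have {low} ball := phi_incl_all be low.
have [h hb] := fin_all_exists (fun j => ball (io (c j))).
have {hb}[be' hb] := fin_all_exists hb.
have [C hC] := fin_all_exists (fun t : J * T * I => image_span (be' t.1.1 t.2 * y t.1.2)).
rewrite leqNgt; apply/negP => IJ.
pose x (t : J * T) : S := io (c t.1) * theta (h t.1) * phi (y t.2).
pose g (s : I * T) : S := b s.1 * phi (y s.2).
have xE t : x t = \sum_s theta (C (t, s.1) s.2) * g s.
  rewrite /x (hb t.1).2 mulr_suml -(pair_bigA _ (fun i s => theta (C (t, i) s) * g (i, s))) /=.
  apply: eq_bigr => i _; rewrite -mulrA -rmorphM (hC (t, i)) /= mulr_sumr.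
  by apply: eq_bigr => s _; rewrite /g /= mulrA [RHS]mulrA theta_central.
have [|v [[[j0 t0] v0] hv]] := span_dependent S_domain xE.
  by rewrite !card_prod ltn_pmul2r.
(* Independence of the [phi (y t)] over the centre splits the relation according to [t], leaving
   relations between the [c j] over the image of [kappa]. *)
have iz t : \sum_j kappa (v (j, t) * h j) * c j = 0.
  apply: io_inj; move: t; apply: y_indep.
  transitivity (\sum_j \sum_s theta (v (j, s)) * x (j, s)); last first.
    by rewrite -[RHS]hv pair_bigA /=; apply: eq_bigr => -[].
  rewrite [RHS]exchange_big /=.
  apply: eq_bigr => s _; rewrite rmorph_sum mulr_suml; apply: eq_bigr => j _.
  rewrite rmorphM /= rmorphM rmorphM -!/(theta _) /x /= mulrA; congr (_ * _).
  by rewrite -[LHS]mulrA; congr (_ * _); rewrite theta_central.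
have /eqP := cI _ (iz t0) j0.
rewrite rmorphM mulf_eq0 => /orP[/eqP vj|/eqP hj].
  by apply: v0; rewrite /= /theta vj rmorph0.
by have [+ _] := hb j0; apply; rewrite /theta hj rmorph0.
Qed.

End AbstractRank.

(** * The degree of the extension of centres *)

Lemma frac_repr (R : idomainType) (x : {fraction R}) :
  exists a b : R, b != 0 /\ x = tofrac a / tofrac b.
Proof.
elim/quotW: x => x; exists \n_x, \d_x; split; first exact: denom_ratioP.
have d0 : tofrac \d_x != 0 by rewrite tofrac_eq0 denom_ratioP.
apply: (canRL (mulfK d0)).
unlock FracField.tofrac; rewrite -[LHS]FracField.pi_mul; apply/eqmodP => /=.
rewrite FracField.equivfE /FracField.mulf !numden_Ratio ?mulf_neq0 ?oner_eq0 ?denom_ratioP //.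
by rewrite !mulr1 mulrC.
Qed.

Section FractionRank.
Variables (R : idomainType) (kappa : {rmorphism R -> R}) (r0 : nat).
Local Notation Fr := {fraction R}.
Local Notation tf := (@FracField.tofrac R).

(** For [kappa] the substitution of [phi0] this unfolds to [gen_subfield phi0]. *)
Definition frac_image (u : Fr) : Prop :=
  exists g h, kappa h != 0 /\ u = tf (kappa g) / tf (kappa h).

Hypothesis bound : forall (J : finType) (c : J -> R),
  (forall v : J -> R, \sum_j kappa (v j) * c j = 0 -> forall j, kappa (v j) = 0) ->
  (#|J| <= r0)%N.

Lemma frac_image_kappa g : frac_image (tf (kappa g)).
Proof. by exists g, 1; rewrite rmorph1 oner_eq0 tofrac1 divr1. Qed.

Lemma frac_image0 : frac_image 0.
Proof. by have := frac_image_kappa 0; rewrite rmorph0 tofrac0. Qed.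

Lemma frac_imageN u : frac_image u -> frac_image (- u).
Proof.
by move=> [g [h [h0 ->]]]; exists (- g), h; rewrite !rmorphN mulNr.
Qed.

Lemma frac_imageM u v : frac_image u -> frac_image v -> frac_image (u * v).
Proof.
move=> [g [h [h0 ->]]] [g' [h' [h'0 ->]]]; exists (g * g'), (h * h').
by rewrite !rmorphM mulf_neq0 // mulf_div.
Qed.

Lemma frac_imageV u : frac_image u -> frac_image u^-1.
Proof.
move=> [g [h [h0 ->]]]; have [->|g0] := eqVneq (kappa g) 0.
  by rewrite tofrac0 mul0r invr0; apply: frac_image0.
by exists h, g; rewrite invf_div.
Qed.

Definition frac_indep k (b : 'I_k -> Fr) : Prop :=
  forall c : 'I_k -> Fr, (forall i, frac_image (c i)) -> \sum_i c i * b i = 0 ->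
  forall i, c i = 0.

(** Multiplication by the product of all denominators carries the family into [R], where [bound]
    applies. *)
Lemma frac_indep_card k (b : 'I_k -> Fr) : frac_indep b -> (k <= r0)%N.
Proof.
move=> bI; have [a ha] := fin_all_exists (fun i => frac_repr (b i)).
have {ha}[e he] := fin_all_exists ha.
pose c i := a i * \prod_(j | j != i) e j.
have cE i : tf (c i) = tf (\prod_j e j) * b i.
  have [e0 ->] := he i; rewrite [in RHS](bigD1 i) //= !tofracM.
  have e0' : tf (e i) != 0 by rewrite tofrac_eq0.
  by rewrite [tf (e i) * _]mulrC -mulrA [tf (e i) * _]mulrCA divff // mulr1 mulrC.
have := bound (J := 'I_k) (c := c); rewrite card_ord; apply=> v s0 i.
apply/eqP; rewrite -tofrac_eq0; apply/eqP; move: i; apply: bI.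
  by move=> i; apply: frac_image_kappa.
have e0 : tf (\prod_j e j) != 0.
  by rewrite tofrac_eq0; apply/prodf_neq0 => i _; have [] := he i.
apply: (mulfI e0); rewrite mulr0 mulr_sumr.
transitivity (tf (\sum_j kappa (v j) * c j)); last by rewrite s0 tofrac0.
by rewrite rmorph_sum; apply: eq_bigr => i _; rewrite rmorphM /= cE mulrCA.
Qed.

(** A longest independent family spans; lengths are bounded by [frac_indep_card]. *)
Lemma frac_basis : exists k (b : 'I_k -> Fr), [/\ (0 < k <= r0)%N, frac_indep b &
  forall u, exists c : 'I_k -> Fr, (forall i, frac_image (c i)) /\ u = \sum_i c i * b i].
Proof.
pose A k := `[< exists b : 'I_k -> Fr, frac_indep b >].
(* Length 1 is attained, so [k] is positive; a prime larger than [k] then cannot divide it. *)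
have A1 : A 1%N.
  apply/asboolP; exists (fun=> 1) => c _; rewrite big_ord1 mulr1 => c0 i.
  by rewrite ord1.
have Ar k : A k -> (k <= r0)%N by move=> /asboolP[b]; apply: frac_indep_card.
have [k /asboolP[b bI] kmax] := ex_maxnP (ex_intro _ 1%N A1) Ar.
exists k, b; split=> // [|u]; first by rewrite kmax //= (frac_indep_card bI).
have : ~~ A (k + 1)%N by apply/negP => /kmax; rewrite addn1 ltnn.
move/asboolPn => nA; apply: contrapT => nu; apply: nA.
exists (fun i => match split i with inl j => b j | inr _ => u end).
move=> c cE; rewrite big_split_ord big_ord1 /=.
rewrite (unsplitK (inr ord0 : 'I_k + 'I_1)) => s0.
have {}s0 : \sum_(i < k) c (lshift 1 i) * b i + c (rshift k ord0) * u = 0.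
  rewrite -[RHS]s0; congr (_ + _); apply: eq_bigr => i _.
  by rewrite (unsplitK (inl i : 'I_k + 'I_1)).
have cu : c (rshift k ord0) = 0.
  apply: contrapT => /eqP cu; apply: nu.
  exists (fun i => - (c (rshift k ord0))^-1 * c (lshift 1 i)); split=> [i|].
    by apply: frac_imageM (cE _); apply: frac_imageN; apply: frac_imageV.
  apply: (mulfI cu); rewrite mulr_sumr.
  transitivity (- \sum_(i < k) c (lshift 1 i) * b i).
    by apply/eqP; rewrite -addr_eq0 addrC s0.
  rewrite -sumrN; apply: eq_bigr => i _.
  by rewrite !mulNr mulrN !mulrA divff // mul1r.
move: s0; rewrite cu mul0r addr0 => /bI cl i.
case: (split_ordP i) => j ->; first exact: cl.
by rewrite ord1.
Qed.

End FractionRank.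

Section RMorphism.
Variables (n : nat) (R : comNzRingType) (z : 'I_(n + n) -> weylR n R).
Hypothesis zrel : wrel z.

Lemma wendo_is_additive : zmod_morphism (wendo z).
Proof. by move=> a b; rewrite wendoD wendoN. Qed.

Lemma wendo_is_multiplicative : monoid_morphism (wendo z).
Proof. by split=> [|a b]; [apply: wendo1 | apply: wendoM]. Qed.

Definition wendo_morphism : {rmorphism weylR n R -> weylR n R} :=
  HB.pack (wendo z)
    (GRing.isZmodMorphism.Build (weylR n R) (weylR n R) (wendo z) wendo_is_additive)
    (GRing.isMonoidMorphism.Build (weylR n R) (weylR n R) (wendo z) wendo_is_multiplicative).

End RMorphism.

Section PrimeCharacteristic.
Variables (n p d : nat) (L : fieldType).
Local Notation W := (weylR n L).
Local Notation V := {mpoly L[n + n]}.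
Local Notation P := {mpoly L[n + n]}.
Local Notation Y := (@wY n L).
Hypothesis charp : p \in [pchar L].
Local Notation T := {ffun 'I_(n + n) -> 'I_p}.

Lemma poly_rank_bound (z : 'I_(n + n) -> W) (F : (n + n).-tuple P) : wrel z ->
  (forall j, z j ^+ p = wiota charp (tnth F j)) ->
  (forall j, (msize (z j : V) <= d.+1)%N) -> ((wrank n d).+1 < p)%N ->
  forall (J : finType) (c : J -> P),
  (forall v : J -> P, \sum_j (v j \mPo F) * c j = 0 -> forall j, v j \mPo F = 0) ->
  (#|J| <= wrank n d)%N.
Proof.
move=> zr zF zd pl J c cI.
have T0 : (0 < #|T|)%N by apply/card_gt0P; exists [ffun=> Ordinal (p_gt0 charp)].
apply: (@central_rank_bound P W (wiota charp) (comp_mpoly F) (wendo_morphism zr) T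
  'I_(n + n) (fun t => mmap1 Y (tmnm t)) Y (fun e a => (msize (a : V) <= e.+1)%N)
  (wrank n d) p _ _ _ _ _ _ _ _ _ _ _ _ J c cI T0).
- exact: wmul_eq0.
- exact: wiota_central.
- exact: wiota_eq0.
- by move=> g; apply: wendo_iota.
- exact: wiota_span.
- move=> H H0; apply: (sum_tmnm_independent charp zr) => [g j|]; first exact: wiota_central.
  by rewrite -[RHS]H0; apply: eq_bigr => t _; rewrite /= mmap1_wY wendoX.
- move=> Q Q0 Q1 QD QM QY; apply: wY_ind => // k a b Qa Qb; apply: QD => //.
  by have := QM a (k%:A) Qa; rewrite /= wendoZ wendo1 mulr_algr.
- by rewrite wdeg1.
- by move=> e e' a ee /leq_trans; apply.
- by move=> e j a ae; rewrite wY_mul (leq_trans (wL_size _ _)).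
(* The [Q i] have degree at most [e], hence below [p], so the nonzero one keeps a nonzero image. *)
- move=> I b e ep rI be; have [Q [Qe [i /eqP Qi] s0]] := wendo_dependent rI zd be.
  exists Q; split=> //; exists i => /= h; apply: Qi.
  by apply: (wendo_low_eq0 charp zr) h; apply: leq_trans (Qe i) ep.
- exact: ltnW.
Qed.

Variables (phi : weyl n L -> weyl n L) (phi0 : 'I_(n + n) -> Defs.polyX n L).
Hypothesis phi_endo : is_weyl_endo phi.
Hypothesis phi0E : forall i, center_iota p (phi0 i) = phi (wexp (Ygen L i) p).
Local Notation F := [tuple phi0 i | i < n + n].
Local Notation z := (wimages phi).

Lemma wimages_pow j : z j ^+ p = wiota charp (tnth F j).
Proof.
have [zr pE] := is_weyl_endoP phi_endo.
rewrite tnth_mktuple -center_iotaE phi0E pE wexpE (wendoXn _ _ zr).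
by rewrite YgenE wendoY.
Qed.

Lemma ext_degree_large : weyl_endo_deg_le phi d -> ((wrank n d).+1 < p)%N ->
  exists r, ~~ (p %| r)%N /\ ext_degree (gen_subfield phi0) r.
Proof.
move=> pd pl; have [zr pE] := is_weyl_endoP phi_endo.
have zd j : (msize (z j : V) <= d.+1)%N by rewrite /wimages /= -YgenE; apply: pd.
have [k [b [/andP[k0 kr] bI bs]]] :=
  frac_basis (kappa := comp_mpoly F) (poly_rank_bound zr wimages_pow zd pl).
exists k; split; first by rewrite gtnNdvd // (leq_ltn_trans kr) // ltnW.
by exists b; split.
Qed.

(** The inverse sends each [Y i ^+ p] to a central element, so substitution of [phi0] is onto the
    polynomials and the two fields coincide. *)
Lemma ext_degree_auto : bijective phi -> ext_degree (gen_subfield phi0) 1.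
Proof.
move=> [psi phiK psiK]; have [zr pE] := is_weyl_endoP phi_endo.
have phiM (a b : W) : phi (a * b) = (phi a : W) * (phi b : W) by rewrite !pE wendoM.
have XG i : exists g : P, g \mPo F = 'X_i.
  have [|g hg] := @central_iota n p L charp (psi (Y i ^+ p)).
    move=> j; apply: (can_inj phiK); rewrite !phiM psiK.
    exact: (centralYp charp).
  exists g; apply: (@wiota_inj n p L charp).
  rewrite -(wendo_iota zr wimages_pow) -pE -hg psiK wYn wiotaX.
  by congr 'X_[_]; apply/mnmP => k; rewrite mnmE mulmnE mulnC.
have [G hG] := fin_all_exists XG.
have surj (q : P) : exists g : P, g \mPo F = q.
  elim/mpolyind: q => [|c m q _ _ [g <-]]; first by exists 0; rewrite comp_mpoly0.
  exists (c *: \prod_i G i ^+ m i + g); rewrite comp_mpolyD comp_mpolyZ rmorph_prod.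
  rewrite mpolyXE_id; congr (_ *: _ + _); apply: eq_bigr => i _.
  by rewrite rmorphXn /= hG.
exists (fun=> 1); split=> [u|c _ c0 k].
  exists (fun=> u); split=> [_|]; last by rewrite big_ord1 mulr1.
  have [a [b [b0 ->]]] := frac_repr u.
  have [g ga] := surj a; have [h hb] := surj b.
  by exists g, h; rewrite ga hb.
by move: c0; rewrite big_ord1 mulr1 => c0; rewrite ord1.
Qed.

End PrimeCharacteristic.

Lemma image_center_exists (n p : nat) (L : fieldType) (charp : p \in [pchar L])
    (phi : weyl n L -> weyl n L) : is_weyl_endo phi ->
  exists phi0 : 'I_(n + n) -> Defs.polyX n L,
    forall i, center_iota p (phi0 i) = phi (wexp (Ygen L i) p).
Proof.
move=> pe; have [zr pE] := is_weyl_endoP pe.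
have [F hF] := image_centre charp zr.
exists (tnth F) => i; rewrite (center_iotaE charp) -hF pE wexpE (wendoXn _ _ zr).
by rewrite YgenE wendoY.
Qed.

(** * Compactness *)

Section ResidueField.
Local Open Scope quotient_scope.
Variable R : comNzRingType.

Definition proper_ideal_pred (I : R -> Prop) : Prop :=
  [/\ I 0, forall x y, I x -> I y -> I (x + y), forall a x, I x -> I (a * x) & ~ I 1].

Lemma maximal_ideal (I : R -> Prop) : proper_ideal_pred I ->
  exists J : R -> Prop, [/\ proper_ideal_pred J, forall x, I x -> J x &
    forall x, ~ J x -> exists a y, J y /\ y + a * x = 1].
Proof.
move=> Ip; pose T := {J : R -> Prop | proper_ideal_pred J /\ forall x, I x -> J x}.
pose le (J J' : T) := `[< forall x, sval J x -> sval J' x >].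
have [||A Atot|J Jmax] := @classical_sets.ZL_preorder T (exist _ I (conj Ip (fun x => id))) le.
- by move=> J; apply/asboolP.
- by move=> J1 J2 J3 /asboolP h /asboolP h'; apply/asboolP => x /h/h'.
- have [[J0 AJ0]|nA] := pselect (exists J, A J); last first.
    by exists (exist _ I (conj Ip (fun x => id))) => J AJ; case: nA; exists J.
  pose U x := exists2 J, A J & sval J x.
  have Up : proper_ideal_pred U /\ forall x, I x -> U x.
    split; last by move=> x Ix; exists J0 => //; apply: (svalP J0).2.
    split.
    - by exists J0 => //; have [[]] := svalP J0.
    - move=> x y [J1 A1 J1x] [J2 A2 J2y].
      have [/asboolP h|/asboolP h] := Atot _ _ A1 A2.
        by exists J2 => //; have [[_ D _ _] _] := svalP J2; apply: D => //; apply: h.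
      by exists J1 => //; have [[_ D _ _] _] := svalP J1; apply: D => //; apply: h.
    - by move=> a x [J1 A1 J1x]; exists J1 => //; have [[_ _ M _] _] := svalP J1; apply: M.
    - by move=> [J1 A1 J11]; have [[_ _ _ n1] _] := svalP J1; apply: n1.
  by exists (exist _ U Up) => J AJ; apply/asboolP => x Jx; exists J.
case: J Jmax => J [Jp IJ] Jmax; exists J; split=> // x nJx.
apply: contrapT => nex; have [J0 JD JM J1] := Jp.
pose K u := exists a y, J y /\ u = y + a * x.
have Kp : proper_ideal_pred K /\ forall u, I u -> K u.
  split; last by move=> u /IJ Ju; exists 0, u; rewrite mul0r addr0.
  split.
  - by exists 0, 0; rewrite mul0r addr0.
  - move=> u v [a [y [Jy ->]]] [b [w [Jw ->]]]; exists (a + b), (y + w).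
    by split; [apply: JD | rewrite mulrDl addrACA].
  - move=> c u [a [y [Jy ->]]]; exists (c * a), (c * y).
    by split; [apply: JM | rewrite mulrDr mulrA].
  - by move=> [a [y [Jy e]]]; apply: nex; exists a, y.
have JK : le (exist _ J (conj Jp IJ)) (exist _ K Kp).
  by apply/asboolP => u /= Ju; exists 0, u; rewrite mul0r addr0.
move/asboolP: (Jmax _ JK) => /(_ x) /= Kx; apply/nJx/Kx.
by exists 1, 0; rewrite mul1r add0r.
Qed.

Lemma residue_field (I : R -> Prop) : proper_ideal_pred I ->
  exists (L : fieldType) (pi : {rmorphism R -> L}),
    (forall x, I x -> pi x = 0) /\ forall y, exists x, pi x = y.
Proof.
move=> /maximal_ideal[J [[J0 JD JM J1] IJ Jmax]].
pose S : {pred R} := fun x => `[< J x >].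
have JN x : J x -> J (- x) by move=> Jx; rewrite -mulN1r; apply: JM.
have Sid : idealr_closed S.
  split; [exact/asboolP | exact/asboolPn | ].
  by move=> a x y /asboolP Jx /asboolP Jy; apply/asboolP/JD => //; apply: JM.
pose SI : idealr R := HB.pack S (isIdealr.Build R S Sid).
pose Q := {ideal_quot SI}.
have pi0 x : J x -> \pi_Q x = 0.
  move=> Jx; rewrite -[RHS](raddf0 \pi_Q); apply/eqP.
  by rewrite -Quotient.idealrBE subr0; apply/asboolP.
pose inv (q : Q) : Q := if pselect (exists u, u * q = 1) is left e then projT1 (cid e) else 0.
have mulV (q : Q) : q != 0 -> inv q * q = 1.
  rewrite /inv; case: pselect => [e _|ne q0]; first exact: (projT2 (cid e)).
  case: ne; elim/quotW: q q0 => x x0.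
  have [|a [y [Jy e]]] := Jmax x; first by move=> /pi0/eqP; apply/negP.
  exists (\pi_Q a); have : \pi_Q (y + a * x) = 1 by rewrite e rmorph1.
  by rewrite rmorphD rmorphM /= pi0 // add0r.
have inv0 : inv 0 = 0.
  rewrite /inv; case: pselect => // e; exfalso; case: e => u /eqP.
  by rewrite mulr0 eq_sym oner_eq0.
pose L : fieldType := HB.pack Q (GRing.ComNzRing_isField.Build Q mulV inv0).
exists L, (\pi_Q : {rmorphism R -> Q}); split=> [x /IJ/pi0 //|].
by elim/quotW => x; exists x.
Qed.

End ResidueField.

(** * Products of fields and their residue fields *)

Definition prodF (K : nat -> fieldType) := forall i, K i.

Section Product.
Variable K : nat -> fieldType.
Local Notation R := (prodF K).

HB.instance Definition _ := gen_eqMixin R.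
HB.instance Definition _ := gen_choiceMixin R.

Let ext (f g : R) : (forall i, f i = g i) -> f = g.
Proof. exact: functional_extensionality_dep. Qed.

Definition prodF_zero : R := fun=> 0.
Definition prodF_one : R := fun=> 1.
Definition prodF_add (f g : R) : R := fun i => f i + g i.
Definition prodF_opp (f : R) : R := fun i => - f i.
Definition prodF_mul (f g : R) : R := fun i => f i * g i.

Lemma prodF_addA : associative prodF_add.
Proof. by move=> f g h; apply: ext => i; apply: addrA. Qed.
Lemma prodF_addC : commutative prodF_add.
Proof. by move=> f g; apply: ext => i; apply: addrC. Qed.
Lemma prodF_add0 : left_id prodF_zero prodF_add.
Proof. by move=> f; apply: ext => i; apply: add0r. Qed.
Lemma prodF_addN : left_inverse prodF_zero prodF_opp prodF_add.
Proof. by move=> f; apply: ext => i; apply: addNr. Qed.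
HB.instance Definition _ :=
  GRing.isZmodule.Build R prodF_addA prodF_addC prodF_add0 prodF_addN.

Lemma prodF_mulA : associative prodF_mul.
Proof. by move=> f g h; apply: ext => i; apply: mulrA. Qed.
Lemma prodF_mulC : commutative prodF_mul.
Proof. by move=> f g; apply: ext => i; apply: mulrC. Qed.
Lemma prodF_mul1 : left_id prodF_one prodF_mul.
Proof. by move=> f; apply: ext => i; apply: mul1r. Qed.
Lemma prodF_mulD : left_distributive prodF_mul prodF_add.
Proof. by move=> f g h; apply: ext => i; apply: mulrDl. Qed.
Lemma prodF_one_neq0 : prodF_one != prodF_zero.
Proof.
apply/eqP => e; have : prodF_one 0%N = prodF_zero 0%N by rewrite e.
by move/eqP; rewrite oner_eq0.
Qed.
HB.instance Definition _ := GRing.Zmodule_isComNzRing.Build R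
  prodF_mulA prodF_mulC prodF_mul1 prodF_mulD prodF_one_neq0.

Definition prodF_proj (i : nat) (f : R) : K i := f i.

Lemma prodF_proj_additive i : zmod_morphism (prodF_proj i). Proof. by []. Qed.
Lemma prodF_proj_multiplicative i : monoid_morphism (prodF_proj i). Proof. by []. Qed.
HB.instance Definition _ i :=
  GRing.isZmodMorphism.Build R (K i) (prodF_proj i) (prodF_proj_additive i).
HB.instance Definition _ i :=
  GRing.isMonoidMorphism.Build R (K i) (prodF_proj i) (prodF_proj_multiplicative i).

Lemma prodFP (f g : R) : (forall i, prodF_proj i f = prodF_proj i g) -> f = g.
Proof. exact: ext. Qed.

(* A maximal ideal containing the functions with finite support; finitely many of
   its elements have a common zero since each generates an idempotent. *)
Lemma ultraproduct (p : nat -> nat) :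
  (forall i, p i \in [pchar (K i)]) -> (forall i, (i < p i)%N) ->
  exists (L : fieldType) (pi : {rmorphism R -> L}),
    [/\ [pchar L] =i pred0, forall y, exists x, pi x = y &
      forall s : seq R, (forall f, f \in s -> pi f = 0) ->
        exists i, forall f, f \in s -> prodF_proj i f = 0].
Proof.
move=> pK ltp; pose I (f : R) := exists N, forall i, (N <= i)%N -> f i = 0.
have Ip : proper_ideal_pred I.
  split.
  - by exists 0%N.
  - move=> f g [N fN] [M gM]; exists (maxn N M) => i; rewrite geq_max => /andP[Ni Mi].
    by rewrite -[LHS]/(f i + g i) fN ?gM ?addr0.
  - by move=> a f [N fN]; exists N => i /fN fi; rewrite -[LHS]/(a i * f i) fi mulr0.
  - by move=> [N /(_ _ (leqnn N))/eqP]; rewrite -[X in X == _]/(1 : K N) oner_eq0.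
have [L [pi [piI pi_surj]]] := residue_field Ip.
exists L, pi; split=> // [q|s s0].
  rewrite [RHS]inE; apply/negP => qL.
  have q_pr := pcharf_prime qL; have q0 := pcharf0 qL.
  (* [u] agrees with [q] outside a finite set, yet is invertible: from the index [q] on, the
     characteristic exceeds [q]. *)
  pose u : R := fun i => if (i < q)%N then 1 else q%:R.
  have uE : pi u = 0.
    have -> : u = q%:R + (u - q%:R) by rewrite addrC subrK.
    rewrite rmorphD rmorph_nat q0 add0r; apply: piI; exists q => i qi.
    rewrite -[LHS]/(prodF_proj i (u - q%:R)) rmorphB rmorph_nat /= -[prodF_proj i u]/(u i) /u.
    by rewrite ltnNge qi subrr.
  pose v : R := fun i => (u i)^-1.
  have uv : u * v = 1.
    apply: ext => i; rewrite -[LHS]/(u i * (u i)^-1) mulfV // /u.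
    case: ltnP => [|qi]; first by rewrite oner_eq0.
    apply/eqP => qi0; have : q \in [pchar (K i)] by rewrite inE /= q_pr qi0 eqxx.
    rewrite (pcharf_eq (pK i)) => /eqP qp.
    by have := ltp i; rewrite -qp ltnNge qi.
  have := congr1 pi uv; rewrite rmorphM uE mul0r rmorph1 => /esym/eqP.
  by rewrite oner_eq0.
pose inv (f : R) : R := fun i => (f i)^-1.
(* The component of [1 - f * inv f] is 1 where [f] vanishes and 0 elsewhere. As [P] maps to 1, some
   component of it is nonzero, and there all of [s] vanishes. *)
pose P : R := \prod_(f <- s) (1 - f * inv f).
have P1 : pi P = 1.
  rewrite rmorph_prod big_seq big1 // => f /s0 f0.
  by rewrite rmorphB rmorphM f0 mul0r subr0 rmorph1.
have [i Pi] : exists i, prodF_proj i P != 0.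
  apply: contrapT => nex; have P0 : P = 0.
    by apply: prodFP => i; rewrite rmorph0; apply/eqP/negPn/negP => h; apply: nex; exists i.
  by move: P1; rewrite P0 rmorph0 => /esym/eqP; rewrite oner_eq0.
exists i => f fs; apply/eqP; apply: contraNT Pi => fi.
rewrite rmorph_prod (big_rem f) //= rmorphB rmorphM rmorph1 /= -[prodF_proj i (inv f)]/((f i)^-1).
by rewrite -[prodF_proj i f]/(f i) divff // subrr mul0r.
Qed.

End Product.

Lemma mpoly_of_coeffs (N : nat) (R : nzRingType) (c : 'X_{1..N} -> R) (k : nat) :
  exists a : {mpoly R[N]}, (msize a <= k)%N /\
    forall m, a@_m = if (mdeg m < k)%N then c m else 0.
Proof.
exists (\sum_(m : bmultinom N k) c m *: 'X_[m]).
have h m : (\sum_(m : bmultinom N k) c m *: 'X_[R, m])@_m =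
    if (mdeg m < k)%N then c m else 0.
  have [mk|mk] := ltnP; first exact: mcoeff_mpoly.
  rewrite raddf_sum big1 //= => i _; rewrite mcoeffZ mcoeffX.
  by case: eqP => [im|_]; rewrite ?mulr0 //; have := bmdeg i; rewrite im ltnNge mk.
split=> //; apply/msize_leP => m; rewrite mcoeff_msupp h.
by case: ltnP => //; rewrite eqxx.
Qed.

Section Transfer.
Variables (n : nat) (R R' : comNzRingType) (f : {rmorphism R -> R'}).

Lemma wmap_womega (i j : 'I_(n + n)) :
  wmap f (womega (weylR n R) i j) = womega (weylR n R') i j.
Proof. by rewrite /womega rmorphB !rmorph_nat. Qed.

Lemma wrel_wmap (z : 'I_(n + n) -> weylR n R) : wrel z -> wrel (wmap f \o z).
Proof. by move=> zr i j; rewrite /= -!rmorphM -rmorphB zr; apply: wmap_womega. Qed.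

Lemma msize_wmap (a : weylR n R) :
  (msize (wmap f a : {mpoly R'[n + n]}) <= msize (a : {mpoly R[n + n]}))%N.
Proof.
apply/msize_leP => m; rewrite mcoeff_msupp mcoeff_wmap => nz.
apply: msize_mdeg_lt; rewrite mcoeff_msupp; apply: contraNneq nz => ->.
by rewrite rmorph0.
Qed.

Lemma wmap_lift (b : weylR n R') :
  (forall m, exists x, f x = (b : {mpoly R'[n + n]})@_m) ->
  exists a : weylR n R, wmap f a = b /\
    (msize (a : {mpoly R[n + n]}) <= msize (b : {mpoly R'[n + n]}))%N.
Proof.
move=> /choice[x hx].
have [a [ak ha]] := mpoly_of_coeffs x (msize (b : {mpoly R'[n + n]})).
exists a; split=> //; apply/mpolyP => m; rewrite mcoeff_wmap ha.
case: ltnP => [_|mb]; first exact: hx.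
by rewrite rmorph0 memN_msupp_eq0 // msize_mdeg_ge.
Qed.

End Transfer.

Section Inverse.
Variables (n : nat) (R : comNzRingType).
Local Notation W := (weylR n R).

(** Restates bijectivity as equations between the images of the generators, the form that passes
    through ring morphisms; [wendo_bijective] is the way back. *)
Lemma wendo_inverse (z : 'I_(n + n) -> W) : wrel z -> bijective (wendo z) ->
  exists g : 'I_(n + n) -> W, [/\ wrel g, forall j, wendo z (g j) = wY R j &
    forall j, wendo g (z j) = wY R j].
Proof.
have wendo_nat z' k : wendo z' k%:R = (k%:R : W).
  elim: k => [|k IH]; first by rewrite !mulr0n wendo0.
  by rewrite !mulrS wendoD wendo1 IH.
move=> zr [psi zK Kz]; pose g j := psi (wY R j); exists g.
have gz j : wendo z (g j) = wY R j by rewrite /g Kz.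
split=> // [i j|j].
  apply: (can_inj zK); rewrite wendoD wendoN !(wendoM zr) !gz wY_rel.
  by rewrite /womega wendoD wendoN !wendo_nat.
apply: (can_inj zK); rewrite wendo_comp // wendoY.
rewrite -[RHS]wendo_wY /wendo /wev /mmap; apply: eq_bigr => m _; congr (_ * _).
by rewrite /mmap1; apply: eq_bigr => i _; rewrite -gz.
Qed.

Lemma wendo_bijective (z g : 'I_(n + n) -> W) : wrel z -> wrel g ->
  (forall j, wendo z (g j) = wY R j) -> (forall j, wendo g (z j) = wY R j) ->
  bijective (wendo z).
Proof. by move=> zr gr zg gz; exists (wendo g) => a; apply: wendoK. Qed.

End Inverse.

Section Compactness.
Variables (n : nat) (K : nat -> fieldType).
Local Notation R := (prodF K).

Lemma wmap_prodFP (a b : weylR n R) :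
  (forall i, wmap (prodF_proj i) a = wmap (prodF_proj i) b) -> a = b.
Proof.
move=> ab; apply/mpolyP => m; apply: prodFP => i.
have := congr1 (fun x : weylR n (K i) => (x : {mpoly K i[n + n]})@_m) (ab i).
by rewrite !mcoeff_wmap.
Qed.

(** The uniform degree bound is what lets a sequence of elements be a single polynomial over the
    product. *)
Lemma wmap_prodF_lift (d : nat) (a : forall i, weylR n (K i)) :
  (forall i, msize (a i : {mpoly K i[n + n]}) <= d)%N ->
  exists A : weylR n R, (msize (A : {mpoly R[n + n]}) <= d)%N /\
    forall i, wmap (prodF_proj i) A = a i.
Proof.
move=> ad; have [A [Ad hA]] := mpoly_of_coeffs (fun m => (fun i => (a i : {mpoly _[_]})@_m) : R) d.
exists A; split=> // i; apply/mpolyP => m; rewrite mcoeff_wmap hA.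
case: ltnP => // dm; rewrite rmorph0 memN_msupp_eq0 //.
exact: msize_mdeg_ge (leq_trans (ad i) dm).
Qed.

Lemma wmap_common_zero (L : fieldType) (pi : {rmorphism R -> L}) (J : finType)
    (a : J -> weylR n R) :
  (forall s : seq R, (forall f, f \in s -> pi f = 0) ->
     exists i, forall f, f \in s -> prodF_proj i f = 0) ->
  (forall j, wmap pi (a j) = 0) -> exists i, forall j, wmap (prodF_proj i) (a j) = 0.
Proof.
move=> zero a0.
pose s := flatten [seq [seq (a j : {mpoly R[n + n]})@_m | m <- msupp (a j : {mpoly R[n + n]})] | j <- enum J].
have [|i hi] := zero s.
  move=> f /flatten_mapP[j _ /mapP[m _ ->]].
  by rewrite -mcoeff_wmap a0 mcoeff0.
exists i => j; apply/mpolyP => m; rewrite mcoeff_wmap mcoeff0.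
have [ms|/memN_msupp_eq0 ->] := boolP (m \in msupp (a j : {mpoly R[n + n]})).
  apply: hi; apply/flatten_mapP; exists j; first by rewrite mem_enum.
  by apply/mapP; exists m.
exact: rmorph0.
Qed.

End Compactness.

Lemma ndc_eventually (n d : nat) : CDC0 n d ->
  exists N : nat, forall p : nat, prime p -> (N < p)%N -> NDC n p d.
Proof.
move=> cdc; apply: contrapT => no.
pose Bad (i : nat) (y : {K : fieldType & (nat * ('I_(n + n) -> weylR n K))%type}) :=
  let z := (projT2 y).2 in
  [/\ (projT2 y).1 \in [pchar projT1 y], (i < (projT2 y).1)%N, wrel z,
    forall j, (msize (z j : {mpoly (projT1 y)[n + n]}) <= d.+1)%N & ~ bijective (wendo z)].
have /choice[y hy] : forall i, exists y, Bad i y.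
  move=> i; apply: contrapT => nbad; apply: no; exists i => p p_pr ip K pK phi pe pd.
  have [zr pE] := is_weyl_endoP pe; split=> //.
  apply: contrapT => nbij; apply: nbad; exists (existT _ K (p, wimages phi)).
  split=> //= [j|bij]; first by rewrite /wimages /= -YgenE; apply: pd.
  by apply: nbij; apply: eq_bij bij _ _ => a; rewrite pE.
pose K i := projT1 (y i); pose p i := (projT2 (y i)).1.
pose z i : 'I_(n + n) -> weylR n (K i) := (projT2 (y i)).2.
have pK i : p i \in [pchar (K i)] by have [] := hy i.
have ip i : (i < p i)%N by have [] := hy i.
have zr i : wrel (z i) by have [] := hy i.
have zd i j : (msize (z i j : {mpoly (K i)[n + n]}) <= d.+1)%N
  by have [_ _ _ h _] := hy i; apply: h.
have nb i : ~ bijective (wendo (z i)) by have [] := hy i.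
have [L [pi [L0 pi_surj zero]]] := ultraproduct pK ip.
have [Z hZ] := fin_all_exists (fun j => wmap_prodF_lift (fun i => zd i j)).
have ZE i j : wmap (prodF_proj i) (Z j) = z i j by have [_] := hZ j.
have Zr : wrel Z.
  move=> j k; apply: wmap_prodFP => i.
  by rewrite rmorphB !rmorphM /= !ZE zr wmap_womega.
pose zL := wmap pi \o Z.
have zLr : wrel zL by apply: wrel_wmap.
have [||_ bij] := cdc L L0 (wendo zL : weyl n L -> weyl n L).
- exact: wendo_is_endo.
- move=> j; rewrite YgenE wendoY; apply: leq_trans (msize_wmap _ _) _.
  by have [] := hZ j.
have [g [gr zg gz]] := wendo_inverse zLr bij.
(* The inverse is lifted coefficient by coefficient, so it inverts [Z] only modulo the kernel of
   [pi]. *)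
have [G hG] := fin_all_exists (fun j => wmap_lift (fun m => pi_surj ((g j : {mpoly L[n + n]})@_m))).
have GE j : wmap pi (G j) = g j by have [] := hG j.
(* The finitely many elements whose vanishing says that [G] satisfies the Weyl relations and inverts
   [Z] on both sides. *)
pose E (t : ('I_(n + n) * 'I_(n + n) + ('I_(n + n) + 'I_(n + n)))%type) : weylR n (prodF K) :=
  match t with
  | inl jk => G jk.1 * G jk.2 - G jk.2 * G jk.1 - womega _ jk.1 jk.2
  | inr (inl j) => wendo Z (G j) - wY _ j
  | inr (inr j) => wendo G (Z j) - wY _ j
  end.
have [t|i hi] := @wmap_common_zero n K L pi _ E zero.
  case: t => [[j k]|[j|j]] /=.
  - by rewrite rmorphB rmorphB !rmorphM /= !GE wmap_womega gr subrr.
  - by rewrite rmorphB /= wmap_wendo wmapY GE zg subrr.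
  - rewrite rmorphB /= wmap_wendo wmapY.
    have -> : wendo (wmap pi \o G) (wmap pi (Z j)) = wendo g (zL j).
      by rewrite /wendo /wev /mmap; apply: eq_bigr => m _; congr (_ * _);
        apply: eq_bigr => k _; rewrite /= GE.
    by rewrite gz subrr.
pose gi := wmap (prodF_proj i) \o G.
have wendo_ext (F : fieldType) (u v : 'I_(n + n) -> weylR n F) a :
    (forall j, u j = v j) -> wendo u a = wendo v a.
  move=> uv; rewrite /wendo /wev /mmap; apply: eq_bigr => m _; congr (_ * _).
  by apply: eq_bigr => k _; rewrite uv.
apply: (nb i); apply: (@wendo_bijective n _ (z i) gi (zr i)).
- move=> j k; have := hi (inl (j, k)).
  by rewrite /= rmorphB rmorphB !rmorphM /= wmap_womega => /eqP; rewrite subr_eq0 => /eqP.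
- move=> j; have := hi (inr (inl j)).
  rewrite /= rmorphB /= wmap_wendo wmapY => /eqP; rewrite subr_eq0 => /eqP <-.
  by apply: wendo_ext => k; rewrite /= ZE.
- move=> j; have := hi (inr (inr j)).
  by rewrite /= rmorphB /= wmap_wendo wmapY ZE => /eqP; rewrite subr_eq0 => /eqP <-.
Qed.

(** * Reduction modulo almost every prime *)

Section Specialisation.
Variable K : fieldType.
Hypothesis K0 : [pchar K] =i pred0.

Lemma intr_pchar0 (c : int) : c%:~R = 0 :> K -> c = 0.
Proof.
have nat0 m : m%:R = 0 :> K -> m = 0%N.
  by move/eqP; rewrite ((pcharf0P K).1 K0) => /eqP.
case: c => m; first by move/nat0 ->.
by rewrite NegzE intrN => /eqP; rewrite oppr_eq0 => /eqP/nat0.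
Qed.

(* Modulo almost every prime, [a] is not nilpotent in the image of [psi]. *)
Definition almost_prime_free (R : comNzRingType) (psi : R -> K) : Prop :=
  forall a, psi a != 0 -> exists N, forall p, prime p -> (N < p)%N ->
    forall k b, psi a ^+ k <> p%:R * psi b.

Lemma almost_prime_free_int : almost_prime_free (intr : int -> K).
Proof.
move=> a a0; exists `|a|%N => p p_pr ap k b.
rewrite -[p%:R]/((p%:Z)%:~R) -rmorphXn -intrM => /eqP.
rewrite -subr_eq0 -intrB => /eqP/intr_pchar0 /eqP; rewrite subr_eq0 => /eqP e.
have : (p %| `|a| ^ k)%N by rewrite -abszX e abszM dvdn_mulr.
rewrite Euclid_dvdX // => /andP[/dvdn_leq]; rewrite absz_gt0 => pa _.
have /pa : a != 0 by apply: contraNneq a0 => ->.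
by rewrite leqNgt ap.
Qed.

Section Adjoin.
Variables (R : comNzRingType) (psi : {rmorphism R -> K}) (x : K).
Hypothesis psiF : almost_prime_free psi.

Definition adjoin : {poly R} -> K := horner_eval x \o map_poly psi.
HB.instance Definition _ := GRing.RMorphism.on adjoin.

Lemma adjoinE f : adjoin f = (map_poly psi f).[x]. Proof. by []. Qed.

Lemma adjoin_C c : adjoin c%:P = psi c.
Proof. by rewrite adjoinE map_polyC hornerC. Qed.

(** Values at a transcendental [x] are equal only for equal polynomials over [K], so the condition
    is inherited from leading coefficients, which are multiplicative. *)
Lemma almost_prime_free_transcendental :
  (forall q, adjoin q = 0 -> map_poly psi q = 0) -> almost_prime_free adjoin.
Proof.
move=> tr a a0; pose A := map_poly psi a.
have A0 : A != 0 by apply: contraNneq a0; rewrite adjoinE -/A => ->; rewrite horner0.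
(* The coefficient is taken at the degree of the image of [a], since [psi] may kill higher ones. *)
pose l := a`_(size A).-1.
have lA : psi l = lead_coef A by rewrite /lead_coef coef_map.
have [|N hN] := psiF (a := l); first by rewrite lA lead_coef_eq0.
exists N => p p_pr Np k b; rewrite -rmorphXn => e.
apply: (hN p p_pr Np k b`_(k * (size A).-1)).
have /tr : adjoin (a ^+ k - p%:R * b) = 0.
  by rewrite rmorphB rmorphM rmorph_nat e subrr.
rewrite rmorphB rmorphM rmorph_nat rmorphXn -/A => /eqP; rewrite subr_eq0 => /eqP e'.
transitivity (A ^+ k)`_(k * (size A).-1).
  by rewrite lA -lead_coef_exp lead_coefE size_exp mulnC.
by rewrite e' mulr_natl coefMn coef_map mulr_natl.
Qed.

Lemma adjoin_coef f : adjoin f = \sum_(i < size f) psi f`_i * x ^+ i.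
Proof.
by rewrite adjoinE (horner_coef_wide _ (size_poly _ _)); apply: eq_bigr => i _; rewrite coef_map.
Qed.

(** Pseudo-division by a relation [r] of least degree reduces everything to sizes below [s], where
    the value at [x] determines the coefficients up to [psi]. A relation between powers of [a] then
    gives a multiple [a * c] in the base ring, and an equation [a^k = p b], multiplied by [c^k],
    descends to that ring. Reduction costs a power of the leading coefficient depending on [b]; this
    is why the property speaks of all powers. *)
Lemma almost_prime_free_algebraic (q : {poly R}) :
  map_poly psi q != 0 -> adjoin q = 0 -> almost_prime_free adjoin.
Proof.
move=> q0 qx.
pose A s := `[< exists f, [/\ adjoin f = 0, map_poly psi f != 0 &
  size (map_poly psi f) = s] >].
have exA : exists s, A s by exists (size (map_poly psi q)); apply/asboolP; exists q.
have [s /asboolP[f [fx f0 fs]] smin] := ex_minnP exA.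
(* Truncation makes the leading coefficient of [r] itself survive [psi]. *)
pose r := take_poly s f.
have rf : map_poly psi r = map_poly psi f.
  apply/polyP => i; rewrite !coef_map coef_take_poly; case: ltnP => // si.
  by rewrite raddf0 -coef_map nth_default // fs.
have s0 : (0 < s)%N by rewrite -fs size_poly_gt0.
have lr : psi r`_s.-1 != 0 by rewrite -coef_map rf -fs -lead_coefE lead_coef_eq0.
have sr : size r = s.
  apply/eqP; rewrite eqn_leq size_take_poly leqNgt; apply/negP => rs.
  by move: lr; rewrite nth_default ?rmorph0 ?eqxx // -ltnS prednK.
have rx : adjoin r = 0 by rewrite adjoinE rf -adjoinE.
have {}lr : psi (lead_coef r) != 0 by rewrite lead_coefE sr.
have small (h : {poly R}) : (size h < s)%N -> adjoin h = 0 -> map_poly psi h = 0.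
  move=> hs hx; apply/eqP/negPn/negP => h0.
  have : A (size (map_poly psi h)) by apply/asboolP; exists h.
  by move/smin; rewrite leqNgt (leq_ltn_trans (size_poly _ _)).
have red (h : {poly R}) : exists N (g : {poly R}),
    (size g < s)%N /\ psi (lead_coef r) ^+ N * adjoin h = adjoin g.
  exists (Pdiv.Ring.rscalp h r), (Pdiv.Ring.rmodp h r); split.
    by rewrite -sr Pdiv.Ring.ltn_rmodp -size_poly_gt0 sr.
  have := congr1 adjoin (Pdiv.ComRing.rdivp_eq r h).
  by rewrite rmorphD rmorphM /= rx mulr0 add0r -mul_polyC rmorphM /= adjoin_C rmorphXn.
have K_domain (u v : K) : u * v = 0 -> u = 0 \/ v = 0.
  by move/eqP; rewrite mulf_eq0 => /orP[/eqP|/eqP]; [left|right].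
move=> a a0.
have [N hN] := fin_all_exists (fun i : 'I_s => red (a ^+ i)).
have {hN}[g hg] := fin_all_exists hN.
have gE i : adjoin (g i) = \sum_(j < s.-1) psi (g i)`_j * x ^+ j.
  have [gs _] := hg i; rewrite adjoinE (@horner_coef_wide _ s.-1); last first.
    by rewrite (leq_trans (size_poly _ _)) // -ltnS prednK.
  by apply: eq_bigr => j _; rewrite coef_map.
(* The [s] powers of [a], reduced to size below [s], have only [s.-1] coordinates. *)
have [|v [[i1 v1] hv]] := dependent psi K_domain (fun (i : 'I_s) (j : 'I_s.-1) => (g i)`_j).
  by rewrite !card_ord prednK.
pose w i := v i * lead_coef r ^+ N i.
have wE i : psi (w i) * adjoin a ^+ i = psi (v i) * adjoin (g i).
  by have [_ <-] := hg i; rewrite /w rmorphM !rmorphXn mulrA.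
have w1 : exists i, psi (w i) <> 0.
  exists i1 => /eqP; rewrite /w rmorphM rmorphXn mulf_eq0 expf_eq0 (negPf lr) andbF orbF.
  by move/eqP.
have [|||i0 wi0 e] := power_relation K_domain (t := psi \o w) (a := adjoin a) _ _ _ w1.
- by move=> i; rewrite mulrC.
- exact/eqP.
- under eq_bigr => i _ do rewrite /= wE gE mulr_sumr.
  rewrite exchange_big big1 // => j _ /=.
  under eq_bigr => i _ do rewrite mulrA -rmorphM.
  by rewrite -mulr_suml -rmorph_sum hv mul0r.
pose c := - \sum_(i < s | (i0 < i)%N) (w i)%:P * a ^+ (i - i0).-1.
have {}e : adjoin a * adjoin c = psi (w i0).
  rewrite -[RHS]e /c rmorphN rmorph_sum; congr (_ * - _); apply: eq_bigr => i _.
  by rewrite rmorphM rmorphXn /= adjoin_C.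
(* The product is taken so that one element controls both the norm-like value [w i0] and the leading
   coefficient introduced by pseudo-division. *)
have [|M hM] := psiF (a := lead_coef r * w i0).
  by rewrite rmorphM mulf_neq0 //; apply/eqP.
exists M => p p_pr Mp k b ab.
have [N' [g' [g's g'E]]] := red (b * c ^+ k).
pose h := (lead_coef r ^+ N' * w i0 ^+ k)%:P - p%:R * g'.
have hx : adjoin h = 0.
  have e1 : adjoin (p%:R * g') = p%:R * adjoin g' by rewrite rmorphM rmorph_nat.
  have e2 : adjoin (b * c ^+ k) = adjoin b * adjoin c ^+ k by rewrite rmorphM rmorphXn.
  rewrite /h rmorphB /= e1 adjoin_C -g'E e2 rmorphM !rmorphXn -e exprMn ab.
  by rewrite -(mulrA p%:R) [X in X - _]mulrCA subrr.
have hs : (size h < s)%N.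
  apply: leq_ltn_trans (_ : maxn 1 (size g') < s)%N.
    apply: leq_trans (size_polyD _ _) _; rewrite geq_max !leq_max size_polyC.
    by rewrite size_polyN leq_b1 /= mulr_natl -scaler_nat size_scale_leq orbT.
  (* For [s = 1] the relation [r] would be a constant with nonzero image vanishing at [x]. *)
  rewrite gtn_max g's andbT ltn_neqAle s0 andbT eq_sym; apply/eqP => s1.
  have := rx; rewrite adjoin_coef sr s1 big_ord1 expr0 mulr1 => /eqP.
  by move: lr; rewrite lead_coefE sr s1 => /negPf ->.
have := congr1 (fun u : {poly K} => u`_0) (small h hs hx).
rewrite coef_map coef0 /h coefB coefC eqxx mulr_natl coefMn raddfB raddfMn /=.
move/eqP; rewrite subr_eq0 -mulr_natl => /eqP hk.
(* The exponents [N'] and [k] are both completed to [N' + k]. *)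
apply: (hM p p_pr Mp (N' + k)%N (g'`_0 * (lead_coef r ^+ k * w i0 ^+ N'))).
rewrite [in RHS]rmorphM mulrA -hk !(rmorphM, rmorphXn) exprMn !exprD.
by rewrite [X in _ * X = _]mulrC mulrACA.
Qed.

Lemma almost_prime_free_adjoin : almost_prime_free adjoin.
Proof.
have [tr|ntr] := pselect (forall q, adjoin q = 0 -> map_poly psi q = 0).
  exact: almost_prime_free_transcendental.
have [q [qx q0]] : exists q, adjoin q = 0 /\ map_poly psi q != 0.
  apply: contrapT => nq; apply: ntr => q qx; apply/eqP/negPn/negP => q0.
  by apply: nq; exists q.
exact: almost_prime_free_algebraic q0 qx.
Qed.

End Adjoin.

Lemma almost_prime_free_seq (s : seq K) :
  exists (R : comNzRingType) (psi : {rmorphism R -> K}),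
    almost_prime_free psi /\ forall x, x \in s -> exists r, psi r = x.
Proof.
elim: s => [|x s [R [psi [psiF hs]]]].
  by exists int, intr; split; first exact: almost_prime_free_int.
exists {poly R}, (adjoin psi x); split; first exact: almost_prime_free_adjoin.
move=> y; rewrite inE => /orP[/eqP ->|/hs[r <-]].
  by exists 'X; rewrite /= adjoinE map_polyX hornerX.
by exists r%:P; rewrite /= adjoin_C.
Qed.

(** The residue field is taken at the ideal of elements whose image lies in [p] times the image of
    [psi]; it is proper by [almost_prime_free] at 1. Containing the kernel of [psi], it makes [chi]
    factor through a subring of [K] that contains [s]. *)
Lemma specialisation (s : seq K) :
  exists N, forall p, prime p -> (N < p)%N ->
  exists (L : fieldType) (R : comNzRingType) (psi : {rmorphism R -> K}) (chi : {rmorphism R -> L}),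
    [/\ p \in [pchar L], forall x, x \in s -> exists r, psi r = x &
      forall r, psi r = 0 -> chi r = 0].
Proof.
have [R [psi [psiF hs]]] := almost_prime_free_seq s.
have [|N hN] := psiF 1; first by rewrite rmorph1 oner_eq0.
exists N => p p_pr Np.
have [|L [chi [chi0 _]]] := @residue_field R (fun r => exists b, psi r = p%:R * psi b).
  split.
  - by exists 0; rewrite rmorph0 mulr0.
  - by move=> r r' [b e] [b' e']; exists (b + b'); rewrite !rmorphD e e' mulrDr.
  - by move=> a r [b e]; exists (a * b); rewrite !rmorphM e mulrCA.
  - by move=> [b e]; apply: (hN p p_pr Np 1 b); rewrite expr1.
exists L, R, psi, chi; split=> //.
  rewrite inE /= p_pr -(rmorph_nat chi); apply/eqP/chi0.
  by exists 1; rewrite rmorph_nat rmorph1 mulr1.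
by move=> r r0; apply: chi0; exists 0; rewrite r0 rmorph0 mulr0.
Qed.

End Specialisation.

(** * The equivalence *)

Section CharacteristicZero.
Variables (n d : nat) (K : fieldType).
Hypothesis K0 : [pchar K] =i pred0.
Local Notation W := (weylR n K).
Local Notation V := {mpoly K[n + n]}.
Variable z : 'I_(n + n) -> W.
Hypothesis zrel : wrel z.
Hypothesis zd : forall j, (msize (z j : V) <= d.+1)%N.

Lemma wendo_inj0 : injective (wendo z).
Proof.
suff inj0 a : wendo z a = 0 -> a = 0.
  move=> a b ab; apply/eqP; rewrite -subr_eq0; apply/eqP/inj0.
  by rewrite wendoD wendoN ab subrr.
move=> a0; apply/mpolyP => m; rewrite mcoeff0.
have h : in_alg W (a : V)@_m = 0.
  move: m; apply: (@wev_independent n K W (in_alg W) z zrel _ a _ a0).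
    by move=> c j; apply: wcentral_alg.
  move=> m am i k /andP[k0 km] x /eqP; rewrite -scaler_nat scaler_eq0.
  by rewrite ((pcharf0P K).1 K0) eqn0Ngt k0 => /eqP.
by apply/eqP; move/eqP: h; rewrite scaler_eq0 oner_eq0 orbF.
Qed.

Lemma wendo_surj (g : 'I_(n + n) -> W) : (forall j, wendo z (g j) = wY K j) ->
  forall a, exists b, wendo z b = a.
Proof.
move=> zg; apply: wY_ind => [||c a a' [b <-] [b' <-]|j a [b <-]].
- by exists 0; rewrite wendo0.
- by exists 1; rewrite wendo1.
- by exists (c *: b + b'); rewrite wendoD wendoZ.
- by exists (g j * b); rewrite (wendoM zrel) zg.
Qed.

Lemma wendo_bij0 (g : 'I_(n + n) -> W) : (forall j, wendo z (g j) = wY K j) ->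
  bijective (wendo z).
Proof.
move=> /wendo_surj/choice[h zh]; exists h => // a.
by apply: wendo_inj0; rewrite zh.
Qed.

(** In characteristic 0 the endomorphism is injective, so it must miss a generator. For each [k]
    that generator lies outside the span of the images of the monomials of degree at most [k], and a
    column of the cokernel matrix separates it from them. *)
Lemma separating_form (k : nat) : ~ bijective (wendo z) ->
  exists j (lam : bmultinom (n + n) (k * d).+2 -> K),
    (forall m, (mdeg m <= k)%N -> \sum_t lam t * (mmap1 z m : V)@_t = 0) /\
    \sum_t lam t * (wY K j : V)@_t = 1.
Proof.
move=> nb; apply: contrapT => no; apply: nb.
(* Degree at most [k * d + 1] holds the images and also the generators when [k * d] is 0. *)
pose I := bmultinom (n + n) k.+1; pose J := bmultinom (n + n) (k * d).+2.
pose M : 'M[K]_(#|{: I}|, #|{: J}|) :=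
  \matrix_(i, t) (mmap1 z (enum_val i : I) : V)@_(enum_val t : J).
pose v j : 'rV[K]_#|{: J}| := \row_t (wY K j : V)@_(enum_val t : J).
have vM j : (v j <= M)%MS.
  rewrite submxE; apply/negPn/negP => nz; apply: no.
  have [s ns] : exists s, (v j *m cokermx M) ord0 s != 0.
    apply: contrapT => ns; move/eqP: nz; apply; apply/rowP => s.
    by rewrite [RHS]mxE; apply/eqP/negPn/negP => h; apply: ns; exists s.
  pose c := (v j *m cokermx M) ord0 s.
  (* Normalised to the value 1, which no reduction can kill. *)
  exists j, (fun t => c^-1 * cokermx M (enum_rank t) s); split=> [m mk|].
    have : (M *m cokermx M) (enum_rank (BMultinom (mk : mdeg m < k.+1)%N : I)) s = 0 by rewrite mulmx_coker mxE.
    rewrite mxE (reindex (@enum_rank J)) /=; last exact/onW_bij/enum_rank_bij.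
    under eq_bigr => t _ do rewrite mxE !enum_rankK mulrC.
    move=> s0; under eq_bigr => t _ do rewrite -mulrA.
    by rewrite -mulr_sumr s0 mulr0.
  have : c = c by []; rewrite {1}/c mxE (reindex (@enum_rank J)) /=; last exact/onW_bij/enum_rank_bij.
  under eq_bigr => t _ do rewrite mxE enum_rankK mulrC.
  move=> s0; under eq_bigr => t _ do rewrite -mulrA.
  by rewrite -mulr_sumr s0 mulVf.
have YE j : exists g, wendo z g = wY K j.
  have /submxP[D vD] := vM j.
  exists (\sum_(i < #|{: I}|) D ord0 i *: 'X_[enum_val i : I] : V).
  apply/mpolyP => m; rewrite wendo_sum raddf_sum /=.
  have zE i : (wendo z (D ord0 i *: 'X_[enum_val i : I]) : V)@_m =
      D ord0 i * (mmap1 z (enum_val i : I) : V)@_m.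
    by rewrite wendoZ wendoX mcoeffZ.
  under eq_bigr => i _ do rewrite zE.
  have [mk|mk] := ltnP (mdeg m) (k * d).+2.
    have /rowP/(_ (enum_rank (BMultinom mk : J))) := vD.
    rewrite !mxE enum_rankK /= => ->; apply: eq_bigr => i _.
    by rewrite mxE enum_rankK.
  rewrite big1 => [|i _].
    by rewrite memN_msupp_eq0 // msize_mdeg_ge // wdegY (leq_trans _ mk).
  rewrite memN_msupp_eq0 ?mulr0 // msize_mdeg_ge // (leq_trans (wmsize_mmap1 _ zd)) //.
  apply: leq_trans mk; rewrite ltnS leqW // leq_mul2r -ltnS bmdeg orbT.
  by [].
have [g zg] := fin_all_exists YE.
exact: wendo_bij0 zg.
Qed.

End CharacteristicZero.

Lemma mem_coeffs (N : nat) (R : nzRingType) (J : finType) (a : J -> {mpoly R[N]}) :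
  exists s : seq R, forall j m, (a j)@_m \in s.
Proof.
exists (0 :: flatten [seq [seq (a j)@_m | m <- msupp (a j)] | j <- enum J]) => j m.
rewrite inE; have [ms|/memN_msupp_eq0 ->] := boolP (m \in msupp (a j)); last by rewrite eqxx.
apply/orP; right; apply/flatten_mapP; exists j; first by rewrite mem_enum.
by apply/mapP; exists m.
Qed.

Lemma mmap1_wmap (n : nat) (R R' : comNzRingType) (f : {rmorphism R -> R'})
    (z : 'I_(n + n) -> weylR n R) m :
  wmap f (mmap1 z m) = mmap1 (wmap f \o z) m.
Proof. by rewrite /mmap1 rmorph_prod; apply: eq_bigr => i _; rewrite rmorphXn. Qed.

(* Non-surjectivity up to the a priori degree of an inverse is witnessed by a linear
   form, which survives reduction modulo almost every prime. *)
Lemma nonbijective_reduction (n d : nat) (K : fieldType) (z : 'I_(n + n) -> weylR n K) :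
  [pchar K] =i pred0 -> wrel z ->
  (forall j, (msize (z j : {mpoly K[n + n]}) <= d.+1)%N) -> ~ bijective (wendo z) ->
  exists N, forall p, prime p -> (N < p)%N ->
  exists (L : fieldType) (z' : 'I_(n + n) -> weylR n L),
    [/\ p \in [pchar L], wrel z',
      forall j, (msize (z' j : {mpoly L[n + n]}) <= d.+1)%N & ~ bijective (wendo z')].
Proof.
move=> K0 zr zd nb.
have [j [lam [lam0 lam1]]] := separating_form K0 zr zd (wrank n d) nb.
have [s1 zs] := mem_coeffs (fun j => z j : {mpoly K[n + n]}).
have [N hN] := specialisation K0 (s1 ++ [seq lam t | t : bmultinom (n + n) _]).
exists N => p p_pr Np.
have [L [R [psi [chi [pL hs hk]]]]] := hN p p_pr Np.
have lift j' : exists a : weylR n R, wmap psi a = z j' /\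
    (msize (a : {mpoly R[n + n]}) <= msize (z j' : {mpoly K[n + n]}))%N.
  by apply: wmap_lift => m; apply: hs; rewrite mem_cat zs.
have [Z hZ] := fin_all_exists lift.
have ZE j' : wmap psi (Z j') = z j' by have [] := hZ j'.
have lam_lift t : exists x, psi x = lam t.
  by apply: hs; rewrite mem_cat; apply/orP; right; apply/mapP; exists t; rewrite ?mem_enum.
have [l hl] := fin_all_exists lam_lift.
(* The lifts satisfy the Weyl relations only after [psi]; since [chi] kills its kernel, identities
   valid in [K] pass to [L]. *)
have ker (a : weylR n R) : wmap psi a = 0 -> wmap chi a = 0.
  move=> a0; apply/mpolyP => m; rewrite mcoeff_wmap mcoeff0; apply: hk.
  by rewrite -mcoeff_wmap a0 mcoeff0.
pose z' := wmap chi \o Z.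
have z'r : wrel z'.
  move=> i k; rewrite -(wmap_womega chi) /z' /= -!rmorphM -rmorphB /=.
  apply/eqP; rewrite -subr_eq0 -rmorphB /=; apply/eqP/ker.
  by rewrite rmorphB /= wmap_womega rmorphB !rmorphM /= !ZE zr subrr.
have z'd j' : (msize (z' j' : {mpoly L[n + n]}) <= d.+1)%N.
  apply: leq_trans (msize_wmap _ _) _; have [_ h] := hZ j'.
  exact: leq_trans h (zd j').
exists L, z'; split=> // bij.
have [g [gr zg gz]] := wendo_inverse z'r bij.
(* An inverse of the reduction would have degree at most [wrank n d], putting the generator in the
   span on which the reduced form vanishes, although the form takes the value 1 there. *)
have gd := inverse_degree gr z'd gz.
have form0 m : (mdeg m <= wrank n d)%N ->
    \sum_t chi (l t) * (mmap1 z' m : {mpoly L[n + n]})@_(bmnm t) = 0.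
  move=> mk; rewrite /z' -mmap1_wmap.
  under eq_bigr => t _ do rewrite mcoeff_wmap -rmorphM.
  rewrite -rmorph_sum; apply: hk; rewrite rmorph_sum -[RHS](lam0 m mk).
  apply: eq_bigr => t _; rewrite rmorphM hl -mcoeff_wmap mmap1_wmap.
  congr (_ * (_ : {mpoly _[_]})@_ _); rewrite /mmap1; apply: eq_bigr => i _.
  by rewrite /= ZE.
have form1 : \sum_t chi (l t) * (wY L j : {mpoly L[n + n]})@_(bmnm t) = 1.
  rewrite -(wmapY chi j).
  under eq_bigr => t _ do rewrite mcoeff_wmap -rmorphM.
  rewrite -rmorph_sum -[RHS](rmorph1 chi); apply/eqP; rewrite -subr_eq0 -rmorphB.
  apply/eqP/hk; rewrite rmorphB rmorph_sum rmorph1 -lam1; apply/eqP; rewrite subr_eq0.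
  apply/eqP/eq_bigr => t _; rewrite rmorphM hl -mcoeff_wmap wmapY.
  by [].
move/eqP: form1; rewrite eq_sym -(zg j) [wendo z' (g j)]/(mmap _ _ _) /mmap.
under eq_bigr => t _ do rewrite raddf_sum mulr_sumr.
rewrite exchange_big big_seq big1 ?oner_eq0 // => m /msize_mdeg_lt mg.
have mk : (mdeg m <= wrank n d)%N by rewrite -ltnS (leq_trans mg).
under eq_bigr => t _ do rewrite /= mulr_algl mcoeffZ mulrCA.
by rewrite -mulr_sumr form0 // mulr0.
Qed.

Lemma ndc_cdc (n d p : nat) : prime p -> (n < p)%N -> NDC n p d -> CDC n p d.
Proof.
move=> p_pr np ndc L pL phi pe pd phi0 phi0E; split=> [[_ bij]|_]; last exact: ndc.
split; last by rewrite leqNgt np.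
exists 1%N; split; first by rewrite dvdn1 neq_ltn prime_gt1 // orbT.
exact: (ext_degree_auto pL pe phi0E bij).
Qed.

Theorem theorem6 (n d : nat) : (0 < n)%N -> (0 < d)%N ->
  exists N : nat, (0 < N)%N /\
    (CDC0 n d <-> (forall p : nat, prime p -> (N < p)%N -> CDC n p d)) /\
    (CDC0 n d <-> (forall p : nat, prime p -> (N < p)%N -> NDC n p d)).
Proof.
move=> _ _; have [cdc0|ncdc0] := pselect (CDC0 n d).
  (* The maximum with [n] makes the Jacobian clause vacuous; the successor makes the bound
     positive. *)
  have [N hN] := ndc_eventually cdc0; exists (maxn N n).+1; split=> //.
  have ndc p : prime p -> ((maxn N n).+1 < p)%N -> NDC n p d.
    by move=> p_pr Np; apply: hN => //; lia.
  split; split=> // _ p p_pr Np.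
  by apply: ndc_cdc; rewrite ?p_pr //; [lia | apply: ndc].
have [N hN] : exists N, forall p, prime p -> (N < p)%N ->
    exists (L : fieldType) (z : 'I_(n + n) -> weylR n L),
    [/\ p \in [pchar L], wrel z,
      forall j, (msize (z j : {mpoly L[n + n]}) <= d.+1)%N & ~ bijective (wendo z)].
  apply: contrapT => no; apply: ncdc0 => K K0 phi pe pd; split=> //.
  have [zr pE] := is_weyl_endoP pe; apply: contrapT => nb; apply: no.
  apply: (nonbijective_reduction K0 zr) => [j|bij].
    by rewrite /wimages /= -YgenE; apply: pd.
  by apply: nb; apply: eq_bij bij _ _ => a; rewrite pE.
(* A single prime refutes both statements. It must exceed [N] for the counterexample, [n] for the
   Jacobian clause, and [(wrank n d).+1] for the degree of the extension. *)
have [p pN p_pr] := prime_above (maxn N (maxn n (wrank n d).+1)).+1.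
have [||L [z [pL zr zd nb]]] := hN p => //; first by lia.
have ze := wendo_is_endo zr.
have zdeg : weyl_endo_deg_le (wendo z : weyl n L -> weyl n L) d.
  by move=> j; rewrite YgenE wendoY.
exists 1%N; split=> //; split; split=> // hp; case: nb.
  have [phi0 phi0E] := image_center_exists pL ze.
  have [_ h] := hp p p_pr (prime_gt1 p_pr) L pL _ ze zdeg _ phi0E.
  have [|_ //] := h; split; last by lia.
  by apply: (ext_degree_large pL ze phi0E zdeg); lia.
by have [_] := hp p p_pr (prime_gt1 p_pr) L pL _ ze zdeg.
Qed.
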